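(* Let $(\mathcal A_1,\mathcal H_1,D_1,\gamma_1)$ and $(\mathcal A_2,\mathcal H_2,D_2,\gamma_2)$ be even spectral triples, and let $\mathcal E_1,\mathcal E_2$ be Hermitian finitely generated projective modules over $\mathcal A_1,\mathcal A_2$ respectively. If $\nabla_1\in C(\mathcal E_1)$ and $\nabla_2\in C(\mathcal E_2)$ are compatible connections, then the map $\nabla:\mathcal E_1\otimes\mathcal E_2\to(\mathcal E_1\otimes\mathcal E_2)\otimes_{\mathcal A}\Omega_D^1(\mathcal A)$, $\nabla(e_1\otimes e_2)=\nabla_1(e_1)\otimes e_2+e_1\otimes\nabla_2(e_2)$, is a compatible connection on $\mathcal E=\mathcal E_1\otimes\mathcal E_2$, i.e. $\nabla\in C(\mathcal E)$.
   Context: All algebras are unital; $\otimes$ without subscript is over $\mathbb C$. A spectral triple $(\mathcal A,\mathcal H,D)$ consists of a unital associative $\star$-algebra $\mathcal A$ with a unital faithful $\star$-representation $\pi$ on a separable Hilbert space $\mathcal H$ and an unbounded self-adjoint operator $D$ on $\mathcal H$ with compact resolvent such that each $[D,\pi(a)]$ extends to a bounded operator; $\mathcal A$ is identified with $\pi(\mathcal A)$. The algebras of the given spectral triples are assumed stable under the holomorphic functional calculus in a unital $C^*$-algebra. The triple is even if there is $\gamma=\gamma^*\in\mathcal B(\mathcal H)$, $\gamma^2=1$, commuting with $\mathcal A$ and anticommuting with $D$. $\Omega_D^1(\mathcal A)=\{\sum a_j[D,b_j]\}\subseteq\mathcal B(\mathcal H)$, an $\mathcal A$-bimodule; $d:\mathcal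 A\to\Omega_D^1(\mathcal A)$, $da=[D,a]$ (for $\mathcal A_j$: $d_j$); convention $(da)^*=-d(a^* )$. Product triple: $\mathcal A=\mathcal A_1\otimes\mathcal A_2$, $\mathcal H=\mathcal H_1\otimes\mathcal H_2$, $D=D_1\otimes1+\gamma_1\otimes D_2$, $\gamma=\gamma_1\otimes\gamma_2$. $\Omega^1_D(\mathcal A)=\Omega^1_{D_1}(\mathcal A_1)\otimes\mathcal A_2\oplus\mathcal A_1\otimes\Omega^1_{D_2}(\mathcal A_2)$, where $(\omega_1\otimes a_2,a_1\otimes\omega_2)$ stands for $\omega_1\otimes a_2+\gamma_1a_1\otimes\omega_2$. With this identification the adjoint convention for forms is componentwise: $(\omega_1\otimes a_2,a_1\otimes\omega_2)^*=(\omega_1^*\otimes a_2^*,a_1^*\otimes\omega_2^* )$. Modules are right modules. A Hermitian finitely generated projective module over $\mathcal A$ may be (and is) written $\mathcal E=p\mathcal A^q$ with $p=p^2=p^*\in M_q(\mathcal A)$ and $\langle\xi,\eta\rangle_{\mathcal A}=\sum\xi_j^*\eta_j$. A compatible connection ($\nabla\in C(\mathcal E)$) is a $\mathbb C$-linear map $\nabla:\mathcal E\to\mathcal E\otimes_{\mathcal A}\Omega_D^1(\mathcal A)$ with $\nabla(\xi a)=(\nabla\xi)a+\xi\otimes da$ and $\langle\xi,\nabla\eta\rangle-\langle\nabla\xi,\eta\rangle=d\langle\xi,\eta\rangle_{\mathcal A}$, where if $\nabla\xi=\sum\xi_j\otimes\omega_j$ then $\langle\nabla\xi,\eta\rangle=\sum\omega_j^*\langle\xi_j,\eta\rangle_{\mathcal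 A}$ and $\langle\eta,\nabla\xi\rangle=\sum\langle\eta,\xi_j\rangle_{\mathcal A}\omega_j$. $\mathcal E=\mathcal E_1\otimes\mathcal E_2$ carries the Hermitian structure $\langle e_1\otimes e_2,e_1'\otimes e_2'\rangle=\langle e_1,e_1'\rangle\otimes\langle e_2,e_2'\rangle$. The definition of $\nabla$ uses the canonical isomorphisms $\mathcal E\otimes_{\mathcal A}(\Omega^1_{D_1}(\mathcal A_1)\otimes\mathcal A_2)\cong(\mathcal E_1\otimes_{\mathcal A_1}\Omega^1_{D_1}(\mathcal A_1))\otimes\mathcal E_2$ and $\mathcal E\otimes_{\mathcal A}(\mathcal A_1\otimes\Omega^1_{D_2}(\mathcal A_2))\cong\mathcal E_1\otimes(\mathcal E_2\otimes_{\mathcal A_2}\Omega^1_{D_2}(\mathcal A_2))$. *)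

(* Defs.v *)
From HB Require Import structures.
From mathcomp Require Import all_boot all_order all_algebra.
From mathcomp Require Import generic_quotient ring.
From mathcomp Require Import all_classical all_reals all_analysis.

Set Implicit Arguments.
Unset Strict Implicit.
Unset Printing Implicit Defensive.

Import Order.TTheory GRing.Theory Num.Theory numFieldNormedType.Exports.
Local Open Scope classical_set_scope.
Local Open Scope ring_scope.
Local Open Scope quotient_scope.

(** * Tensor products of complex vector spaces, balanced over an index set

  For operators [r i] on [U] and [l i] on [V], [tensor r l] is the quotient of
  [U (x)_C V] by the relations [r i u (x) v = u (x) l i v].  Two formal sums
  of pairs are identified when no balanced biadditive map separates them,
  i.e. modulo the kernel of the universal such map. *)

Section Tensor.
Variables (C : numClosedFieldType) (U V : lmodType C) (I : Type).
Variables (r : I -> {linear U -> U}) (l : I -> {linear V -> V}).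

Definition balanced (W : zmodType) (f : U -> V -> W) : Prop :=
  [/\ forall u u' v, f (u + u') v = f u v + f u' v,
      forall u v v', f u (v + v') = f u v + f u v',
      forall (c : C) u v, f (c *: u) v = f u (c *: v)
    & forall i u v, f (r i u) v = f u (l i v)].

Definition teval (W : zmodType) (f : U -> V -> W) (s : seq (U * V)) : W :=
  \sum_(p <- s) f p.1 p.2.

Definition teq (s t : seq (U * V)) : bool :=
  `[< forall (W : zmodType) (f : U -> V -> W),
        balanced f -> teval f s = teval f t >].

Lemma teq_equiv : equiv_class_of teq.
Proof.
split=> [s|s t|t s w].
- exact/asboolP.
- by apply/asboolP/asboolP => h W f hf; rewrite h.
- move=> /asboolP h1 /asboolP h2; apply/asboolP => W f hf.
  by rewrite h1 // h2.
Qed.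

Canonical teq_equiv_rel := EquivRelPack teq_equiv.

Definition tensor := {eq_quot teq_equiv_rel}.
HB.instance Definition _ := Choice.on tensor.
HB.instance Definition _ := EqQuotient.on tensor.

Definition tens (u : U) (v : V) : tensor := \pi_tensor [:: (u, v)].

(* The map on the tensor product induced by [f]; it satisfies
   [tlift f (tens u v) = f u v] as soon as [f] is balanced. *)
Definition tlift (W : zmodType) (f : U -> V -> W) (x : tensor) : W :=
  teval f (repr x).

Lemma tensorP s t : teq s t -> \pi_tensor s = \pi_tensor t.
Proof. by move=> h; apply/eqmodP. Qed.

Lemma tlift_pi (W : zmodType) (f : U -> V -> W) s :
  balanced f -> tlift f (\pi s) = teval f s.
Proof.
move=> hf; rewrite /tlift.
have /eqmodP/asboolP : repr (\pi_tensor s) = s %[mod tensor] by rewrite reprK.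
exact.
Qed.

Definition tadd (x y : tensor) : tensor := \pi_tensor (repr x ++ repr y).
Definition topp (x : tensor) : tensor :=
  \pi_tensor [seq (- p.1, p.2) | p <- repr x].
Definition tscale (c : C) (x : tensor) : tensor :=
  \pi_tensor [seq (c *: p.1, p.2) | p <- repr x].

Lemma balanced0l (W : zmodType) (f : U -> V -> W) v : balanced f -> f 0 v = 0.
Proof.
by case=> fD _ _ _; apply: (addrI (f 0 v)); rewrite -fD !addr0.
Qed.

Lemma balancedNl (W : zmodType) (f : U -> V -> W) u v :
  balanced f -> f (- u) v = - f u v.
Proof.
move=> hf; have [fD _ _ _] := hf; apply: (addrI (f u v)).
by rewrite -fD !subrr balanced0l.
Qed.

Lemma balanced_scale (W : zmodType) (f : U -> V -> W) c :
  balanced f -> balanced (fun u v => f (c *: u) v).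
Proof.
case=> fDl fDr fZ fI; split=> [u u' v|u v v'|d u v|i u v].
- by rewrite scalerDr fDl.
- by rewrite fDr.
- by rewrite scalerA mulrC -scalerA fZ.
- by rewrite !fZ fI linearZ.
Qed.

Lemma tensor_eqP (x y : tensor) :
  (forall (W : zmodType) (f : U -> V -> W), balanced f ->
     tlift f x = tlift f y) -> x = y.
Proof.
move=> h; rewrite -(reprK x) -(reprK y); apply/tensorP/asboolP => W f hf.
exact: (h W f hf).
Qed.

Lemma tlift_add (W : zmodType) (f : U -> V -> W) x y :
  balanced f -> tlift f (tadd x y) = tlift f x + tlift f y.
Proof. by move=> hf; rewrite tlift_pi// /teval big_cat. Qed.

Lemma tlift_opp (W : zmodType) (f : U -> V -> W) x :
  balanced f -> tlift f (topp x) = - tlift f x.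
Proof.
move=> hf; rewrite tlift_pi// /teval big_map /tlift /teval -sumrN.
by apply: eq_bigr => p _ /=; rewrite balancedNl.
Qed.

Lemma tlift_scale (W : zmodType) (f : U -> V -> W) c x :
  balanced f -> tlift f (tscale c x) = tlift (fun u v => f (c *: u) v) x.
Proof. by move=> hf; rewrite tlift_pi// /teval big_map. Qed.

Lemma tlift_zero (W : zmodType) (f : U -> V -> W) :
  balanced f -> tlift f (\pi_tensor [::]) = 0.
Proof. by move=> hf; rewrite tlift_pi// /teval big_nil. Qed.

Lemma taddA : associative tadd.
Proof.
by move=> x y z; apply: tensor_eqP => W f hf; rewrite !tlift_add// addrA.
Qed.

Lemma taddC : commutative tadd.
Proof.
by move=> x y; apply: tensor_eqP => W f hf; rewrite !tlift_add// addrC.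
Qed.

Lemma tadd0 : left_id (\pi_tensor [::]) tadd.
Proof.
by move=> x; apply: tensor_eqP => W f hf; rewrite tlift_add// tlift_zero ?add0r.
Qed.

Lemma taddN : left_inverse (\pi_tensor [::]) topp tadd.
Proof.
move=> x; apply: tensor_eqP => W f hf.
by rewrite tlift_add// tlift_opp// tlift_zero// addNr.
Qed.

HB.instance Definition _ := GRing.isZmodule.Build tensor taddA taddC tadd0 taddN.

Lemma tliftD (W : zmodType) (f : U -> V -> W) :
  balanced f -> {morph tlift f : x y / x + y}.
Proof. by move=> hf x y; exact: tlift_add. Qed.

Lemma tscaleA c d x : tscale c (tscale d x) = tscale (c * d) x.
Proof.
apply: tensor_eqP => W f hf; rewrite !tlift_scale//; last exact: balanced_scale.
by apply: eq_bigr => p _ /=; rewrite scalerA mulrC.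
Qed.

Lemma tscale1 : left_id 1 tscale.
Proof.
move=> x; apply: tensor_eqP => W f hf; rewrite tlift_scale//.
by apply: eq_bigr => p _ /=; rewrite scale1r.
Qed.

Lemma tscaleDr : right_distributive tscale +%R.
Proof.
move=> c x y; apply: tensor_eqP => W f hf.
by rewrite tlift_scale// !tliftD ?tlift_scale//; exact: balanced_scale.
Qed.

Lemma tscaleDl x : {morph tscale^~ x : c d / c + d}.
Proof.
move=> c d; apply: tensor_eqP => W f hf.
rewrite tliftD// !tlift_scale// /tlift /teval -big_split.
by apply: eq_bigr => p _ /=; have [fD _ _ _] := hf; rewrite scalerDl fD.
Qed.

HB.instance Definition _ :=
  GRing.Zmodule_isLmodule.Build C tensor tscaleA tscale1 tscaleDr tscaleDl.

Lemma tlift_tens (W : zmodType) (f : U -> V -> W) u v :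
  balanced f -> tlift f (tens u v) = f u v.
Proof. by move=> hf; rewrite tlift_pi// /teval big_seq1. Qed.

Lemma tens_balanced : balanced tens.
Proof.
by split=> *; apply: tensor_eqP => W f hf; rewrite ?tliftD// !tlift_tens//;
   case: hf => fDl fDr fZ fI.
Qed.

Lemma tensDl u u' v : tens (u + u') v = tens u v + tens u' v.
Proof. by case: tens_balanced. Qed.

Lemma tensDr u v v' : tens u (v + v') = tens u v + tens u v'.
Proof. by case: tens_balanced. Qed.

Lemma tens_act i u v : tens (r i u) v = tens u (l i v).
Proof. by case: tens_balanced. Qed.

Lemma tensZl c u v : tens (c *: u) v = c *: tens u v.
Proof.
apply: tensor_eqP => W f hf.
by rewrite [RHS]tlift_scale// !tlift_tens//; exact: balanced_scale.
Qed.

Lemma tensZr c u v : tens u (c *: v) = c *: tens u v.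
Proof. by rewrite -tensZl; case: tens_balanced => _ _ ->. Qed.

Lemma tensor_sum (x : tensor) :
  x = \sum_(p <- repr x) tens p.1 p.2.
Proof.
apply: tensor_eqP => W f hf; rewrite {1}/tlift /teval.
elim: (repr x) => [|p s IH]; first by rewrite !big_nil [RHS]tlift_zero.
by rewrite !big_cons tliftD// tlift_tens// IH.
Qed.

Lemma tensor_ind (P : tensor -> Prop) :
  P 0 -> (forall u v, P (tens u v)) ->
  (forall x y, P x -> P y -> P (x + y)) -> forall x, P x.
Proof.
by move=> P0 Pt PD x; rewrite (tensor_sum x); elim/big_ind: _ => // p _.
Qed.

Lemma tliftE (W : zmodType) (f : U -> V -> W) x :
  tlift f x = \sum_(p <- repr x) f p.1 p.2.
Proof. by []. Qed.

Lemma tlift0 (W : zmodType) (f : U -> V -> W) : balanced f -> tlift f 0 = 0.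
Proof. exact: tlift_zero. Qed.

End Tensor.

Arguments tens {C U V I r l} u v.
Arguments tlift {C U V I r l W} f x.
Arguments balanced {C U V I} r l {W} f.

Section TensorC.
Variable C : numClosedFieldType.

Definition scalop (U : lmodType C) (c : C) : {linear U -> U} :=
  GRing.scale c.

(* [U (x)_C V]: balancing over the scalars adds no relation. *)
Definition tensorC (U V : lmodType C) := tensor (@scalop U) (@scalop V).
HB.instance Definition _ (U V : lmodType C) := GRing.Lmodule.on (tensorC U V).

End TensorC.

Notation "U ⊗ V" := (tensorC U V) (at level 40, left associativity) : type_scope.

Section TensorMap.
Variable C : numClosedFieldType.

Lemma balancedC (U V : lmodType C) (W : zmodType) (f : U -> V -> W) :
    (forall u u' v, f (u + u') v = f u v + f u' v) ->
    (forall u v v', f u (v + v') = f u v + f u v') ->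
    (forall (c : C) u v, f (c *: u) v = f u (c *: v)) ->
  balanced (@scalop C U) (@scalop C V) f.
Proof. by move=> *; split. Qed.

(* [tmap2 f1 f2 (u1 (x) u2) (v1 (x) v2) = f1 u1 v1 (x) f2 u2 v2] *)
Definition tmap2 (U1 U2 V1 V2 W1 W2 : lmodType C)
    (f1 : U1 -> V1 -> W1) (f2 : U2 -> V2 -> W2)
    (x : U1 ⊗ U2) (y : V1 ⊗ V2) : W1 ⊗ W2 :=
  tlift (fun u1 u2 => tlift (fun v1 v2 => (tens (f1 u1 v1) (f2 u2 v2) : W1 ⊗ W2)) y) x.

Definition sesqui (s : C -> C) (U V W : lmodType C) (f : U -> V -> W) : Prop :=
  [/\ forall u u' v, f (u + u') v = f u v + f u' v,
      forall c u v, f (c *: u) v = s c *: f u v,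
      forall u v v', f u (v + v') = f u v + f u v'
    & forall c u v, f u (c *: v) = c *: f u v].

Section Tmap2.
Variables (s : C -> C) (U1 U2 V1 V2 W1 W2 : lmodType C).
Variables (f1 : U1 -> V1 -> W1) (f2 : U2 -> V2 -> W2).
Hypotheses (h1 : sesqui s f1) (h2 : sesqui s f2).

Lemma tmap2_balr u1 u2 :
  balanced (@scalop C V1) (@scalop C V2)
    (fun v1 v2 => (tens (f1 u1 v1) (f2 u2 v2) : W1 ⊗ W2)).
Proof.
have [_ _ a1 z1] := h1; have [_ _ a2 z2] := h2.
apply: balancedC => [u u' v|u v v'|c u v].
- by rewrite a1 tensDl.
- by rewrite a2 tensDr.
- by rewrite z1 z2 tensZl tensZr.
Qed.

Lemma tmap2_ball (y : V1 ⊗ V2) :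
  balanced (@scalop C U1) (@scalop C U2) (fun u1 u2 =>
    tlift (fun v1 v2 => (tens (f1 u1 v1) (f2 u2 v2) : W1 ⊗ W2)) y).
Proof.
have [a1 z1 _ _] := h1; have [a2 z2 _ _] := h2.
apply: balancedC => [u u' v|u v v'|c u v];
    rewrite !tliftE -?big_split; apply: eq_bigr => p _ /=.
- by rewrite a1 tensDl.
- by rewrite a2 tensDr.
- by rewrite z1 z2 tensZl tensZr.
Qed.

Lemma tmap2_tens u1 u2 v1 v2 :
  tmap2 f1 f2 (tens u1 u2) (tens v1 v2) = tens (f1 u1 v1) (f2 u2 v2).
Proof.
rewrite /tmap2 tlift_tens; last exact: tmap2_ball.
by rewrite tlift_tens//; exact: tmap2_balr.
Qed.

Lemma tmap2Dl x x' y : tmap2 f1 f2 (x + x') y = tmap2 f1 f2 x y + tmap2 f1 f2 x' y.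
Proof. by apply: tliftD; exact: tmap2_ball. Qed.

Lemma tmap2Dr x y y' : tmap2 f1 f2 x (y + y') = tmap2 f1 f2 x y + tmap2 f1 f2 x y'.
Proof.
rewrite /tmap2 !(tliftE _ x) -big_split; apply: eq_bigr => p _ /=.
by apply: tliftD; exact: tmap2_balr.
Qed.

Lemma tmap20l y : tmap2 f1 f2 0 y = 0.
Proof. by apply: tlift0; exact: tmap2_ball. Qed.

Lemma tmap20r x : tmap2 f1 f2 x 0 = 0.
Proof. by apply: (addrI (tmap2 f1 f2 x 0)); rewrite -tmap2Dr !addr0. Qed.

Lemma tmap2Zl c x y : tmap2 f1 f2 (c *: x) y = s c *: tmap2 f1 f2 x y.
Proof.
have [_ z1 _ _] := h1.
elim/tensor_ind: x => [|u1 u2|x x' IH IH']; first by rewrite scaler0 tmap20l scaler0.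
  elim/tensor_ind: y => [|v1 v2|y y' IH IH']; first by rewrite !tmap20r scaler0.
    by rewrite -tensZl !tmap2_tens z1 tensZl.
  by rewrite !tmap2Dr IH IH' scalerDr.
by rewrite scalerDr !tmap2Dl IH IH' scalerDr.
Qed.

Lemma tmap2Zr c x y : tmap2 f1 f2 x (c *: y) = c *: tmap2 f1 f2 x y.
Proof.
have [_ _ _ z1] := h1.
elim/tensor_ind: x => [|u1 u2|x x' IH IH']; first by rewrite !tmap20l scaler0.
  elim/tensor_ind: y => [|v1 v2|y z IH IH']; first by rewrite scaler0 tmap20r scaler0.
    by rewrite -tensZl !tmap2_tens z1 tensZl.
  by rewrite scalerDr !tmap2Dr IH IH' scalerDr.
by rewrite !tmap2Dl IH IH' scalerDr.
Qed.

Lemma tmap2_sesqui : sesqui s (tmap2 f1 f2).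
Proof.
split; [exact: tmap2Dl|exact: tmap2Zl|exact: tmap2Dr|exact: tmap2Zr].
Qed.

End Tmap2.
End TensorMap.

(** * Star-algebras *)

(* Unital associative complex star-algebras, nonzero as all [algType]s are. *)
HB.mixin Record isStarAlgebra (C : numClosedFieldType) A
    of GRing.Algebra C A := {
  star : A -> A;
  starK : involutive star;
  starD : {morph star : a b / a + b};
  starZ : forall (c : C) (a : A), star (c *: a) = c^* *: star a;
  starM : forall a b : A, star (a * b) = star b * star a
}.

#[short(type="starAlgType")]
HB.structure Definition StarAlgebra (C : numClosedFieldType) :=
  {A of GRing.Algebra C A & isStarAlgebra C A}.

Notation "a '^†'" := (star a) (at level 2, format "a '^†'") : ring_scope.

Lemma normalized_functional (C : numClosedFieldType) (V : lmodType C) (e : V) :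
  e != 0 -> exists2 phi : V -> C,
    forall c x y, phi (c *: x + y) = c * phi x + phi y & phi e = 1.
Proof.
move=> e0.
pose P (S : set V) := (forall (c : C) x y, S x -> S y -> S (c *: x + y)) /\ ~ S e.
have [M [[Ml Me] Mmax]] : exists M, P M /\ forall B, M `<` B -> ~ P B.
  apply: Zorn_bigcup => F FP Ftot; split=> [c x y [X FX Xx] [Y FY Yy]|[X FX Xe]].
    by have [XY|YX] := Ftot _ _ FX FY;
      [exists Y|exists X] => //; apply: (proj1 (FP _ _)) => //; [exact: XY|exact: YX].
  exact: (proj2 (FP _ FX)).
have M0 : M 0.
  apply: contrapT => nM0; apply: (Mmax [set 0]).
    split=> [x Mx|/(_ 0 erefl)//].
    by case: nM0; rewrite -(addNr x) -scaleN1r; exact: Ml.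
  split=> [c x y /= -> ->|/= /eqP]; first by rewrite scaler0 addr0.
  by rewrite (negPf e0).
have MZ c x : M x -> M (c *: x) by move=> Mx; rewrite -[_ *: _]addr0; exact: Ml.
have MD x y : M x -> M y -> M (x + y).
  by move=> Mx My; rewrite -[x]scale1r; exact: Ml.
have dec v : exists c, M (v - c *: e).
  have [Mv|nMv] := pselect (M v); first by exists 0; rewrite scale0r subr0.
  pose B := [set w | exists c, M (w - c *: v)].
  have : ~ P B.
    apply: Mmax; split=> [x Mx|sBM]; first by exists 0; rewrite scale0r subr0.
    by apply: nMv; apply: sBM; exists 1; rewrite scale1r subrr.
  have Bl c x y : B x -> B y -> B (c *: x + y).
    move=> [a Ma] [b Mb]; exists (c * a + b).
    have -> : c *: x + y - (c * a + b) *: v = c *: (x - a *: v) + (y - b *: v).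
      by rewrite scalerDl -scalerA scalerBr opprD addrACA.
    exact: Ml.
  move=> nPB; have [c Mc] : B e by apply: contrapT => nBe; apply: nPB.
  have c0 : c != 0.
    by apply/eqP => c0; apply: Me; move: Mc; rewrite c0 scale0r subr0.
  exists c^-1; have -> : v - c^-1 *: e = - c^-1 *: (e - c *: v).
    by rewrite scalerBr scalerA mulNr mulVf// scaleN1r opprK scaleNr addrC.
  exact: MZ.
have uniq v c d : M (v - c *: e) -> M (v - d *: e) -> c = d.
  move=> Mc Md; apply/eqP; rewrite -subr_eq0; apply/negP => /negP cd.
  apply: Me; have -> : e = (c - d)^-1 *: (v - d *: e + -1 *: (v - c *: e)).
    rewrite scaleN1r opprB [X in _ *: X]addrC addrA subrK -scalerBl scalerA.
    by rewrite mulVf ?scale1r.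
  by apply: (MZ); apply: MD => //; apply: MZ.
pose phi v := sval (cid (dec v)).
have phiP v : M (v - phi v *: e) by rewrite /phi; case: cid.
exists phi => [c x y|]; last first.
  by apply: (uniq e) => //; rewrite scale1r subrr.
apply: (uniq (c *: x + y)) => //.
have -> : c *: x + y - (c * phi x + phi y) *: e =
          c *: (x - phi x *: e) + (y - phi y *: e).
  by rewrite scalerDl -scalerA scalerBr opprD addrACA.
exact: Ml.
Qed.

(** ** The star-algebra structure of [A1 ⊗ A2] *)

Section TensorAlgebra.
Variables (C : numClosedFieldType) (A1 A2 : starAlgType C).
Local Notation A := (A1 ⊗ A2).

Definition tmul : A -> A -> A :=
  tmap2 (fun a b : A1 => a * b) (fun a b : A2 => a * b).
Definition tone : A := tens 1 1.
Definition tstar (x : A) : A :=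
  tlift (fun a1 a2 => (tens (a1^†) (a2^†) : A)) x.

Lemma mul_sesqui (B : starAlgType C) : sesqui id (fun a b : B => a * b).
Proof.
split=> *.
- exact: mulrDl.
- by rewrite scalerAl.
- exact: mulrDr.
- by rewrite scalerAr.
Qed.

Lemma tmul_tens a1 a2 b1 b2 :
  tmul (tens a1 a2) (tens b1 b2) = tens (a1 * b1) (a2 * b2).
Proof. exact: (tmap2_tens (mul_sesqui A1) (mul_sesqui A2)). Qed.

Lemma tmulDl : left_distributive tmul +%R.
Proof. by move=> x y z; exact: (tmap2Dl (mul_sesqui A1) (mul_sesqui A2)). Qed.

Lemma tmulDr : right_distributive tmul +%R.
Proof. by move=> x y z; exact: (tmap2Dr (mul_sesqui A1) (mul_sesqui A2)). Qed.

Lemma tmul0l x : tmul 0 x = 0.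
Proof. exact: (tmap20l (mul_sesqui A1) (mul_sesqui A2)). Qed.

Lemma tmul0r x : tmul x 0 = 0.
Proof. exact: (tmap20r (mul_sesqui A1) (mul_sesqui A2)). Qed.

Lemma tmulA : associative tmul.
Proof.
elim/tensor_ind => [|a1 a2|x x' IH IH'] y z; first by rewrite !tmul0l.
  elim/tensor_ind: y => [|b1 b2|y y' IH IH'].
  - by rewrite tmul0l tmul0r tmul0l.
  - elim/tensor_ind: z => [|c1 c2|z z' IH IH'].
    + by rewrite !tmul0r.
    + by rewrite !tmul_tens !mulrA.
    + by rewrite !tmulDr IH IH'.
  - by rewrite tmulDl !tmulDr tmulDl IH IH'.
by rewrite !tmulDl IH IH'.
Qed.

Lemma tmul1l : left_id tone tmul.
Proof.
elim/tensor_ind => [|a1 a2|x x' IH IH']; first by rewrite tmul0r.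
  by rewrite tmul_tens !mul1r.
by rewrite tmulDr IH IH'.
Qed.

Lemma tmul1r : right_id tone tmul.
Proof.
elim/tensor_ind => [|a1 a2|x x' IH IH']; first by rewrite tmul0l.
  by rewrite tmul_tens !mulr1.
by rewrite tmulDl IH IH'.
Qed.

Lemma tone_neq0 : tone != 0.
Proof.
have [phi phi_lin phi1] := normalized_functional (oner_neq0 A2).
have bal : balanced (@scalop C A1) (@scalop C A2) (fun a b => phi b *: a).
  apply: balancedC => [u u' v|u v v'|c u v].
  - by rewrite scalerDr.
  - by rewrite -[v]scale1r phi_lin mul1r scale1r scalerDl.
  - have phi0 : phi 0 = 0.
      by apply: (addrI (phi 0)); rewrite -{1}[phi 0]mul1r -phi_lin scaler0 !addr0.
    by rewrite -[c *: v]addr0 phi_lin phi0 addr0 !scalerA mulrC.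
apply/eqP => /(congr1 (tlift (fun a b => phi b *: a))).
rewrite tlift_tens// tlift0// phi1 scale1r; exact/eqP/oner_neq0.
Qed.

HB.instance Definition _ := GRing.Zmodule_isNzRing.Build A
  tmulA tmul1l tmul1r tmulDl tmulDr tone_neq0.

Lemma tstar_bal : balanced (@scalop C A1) (@scalop C A2)
  (fun a1 a2 => (tens (a1^†) (a2^†) : A)).
Proof.
apply: balancedC => *.
- by rewrite starD tensDl.
- by rewrite starD tensDr.
- by rewrite !starZ tensZl tensZr.
Qed.

Lemma tstar_tens a1 a2 : tstar (tens a1 a2) = tens (a1^†) (a2^†).
Proof. exact: tlift_tens tstar_bal. Qed.

Lemma tstarD : {morph tstar : x y / x + y}.
Proof. exact: tliftD tstar_bal. Qed.

Lemma tstar0 : tstar 0 = 0.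
Proof. exact: tlift0 tstar_bal. Qed.

Lemma tscaleAl (c : C) (x y : A) : c *: (x * y) = c *: x * y.
Proof. exact/esym/(tmap2Zl (mul_sesqui A1) (mul_sesqui A2)). Qed.

Lemma tscaleAr (c : C) (x y : A) : c *: (x * y) = x * (c *: y).
Proof. exact/esym/(tmap2Zr (mul_sesqui A1) (mul_sesqui A2)). Qed.

Lemma tstarK : involutive tstar.
Proof.
elim/tensor_ind => [|a1 a2|x x' IH IH']; first by rewrite !tstar0.
  by rewrite !tstar_tens !starK.
by rewrite !tstarD IH IH'.
Qed.

Lemma tstarZ (c : C) x : tstar (c *: x) = c^* *: tstar x.
Proof.
elim/tensor_ind: x => [|a1 a2|x x' IH IH']; first by rewrite scaler0 tstar0 scaler0.
  by rewrite -tensZl !tstar_tens starZ tensZl.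
by rewrite scalerDr !tstarD IH IH' scalerDr.
Qed.

Lemma tstarM (x y : A) : tstar (x * y) = tstar y * tstar x.
Proof.
elim/tensor_ind: x => [|a1 a2|x x' IH IH'].
- by rewrite mul0r tstar0 mulr0.
- elim/tensor_ind: y => [|b1 b2|y y' IH IH'].
  + by rewrite mulr0 tstar0 mul0r.
  + rewrite [_ * _ in LHS]tmul_tens !tstar_tens [RHS]tmul_tens.
    by rewrite !starM.
  + by rewrite mulrDr !tstarD IH IH' mulrDl.
- by rewrite mulrDl !tstarD IH IH' mulrDr.
Qed.

HB.instance Definition _ := GRing.Lmodule_isLalgebra.Build C A tscaleAl.
HB.instance Definition _ := GRing.Lalgebra_isAlgebra.Build C A tscaleAr.
HB.instance Definition _ := isStarAlgebra.Build C A
  tstarK tstarD tstarZ tstarM.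

End TensorAlgebra.

(** ** C*-algebras and holomorphic functional calculus *)

(* The library has no join of its ring and normed module structures, so the
   Banach space underlying a C*-algebra is given by a linear bijection. *)
Record cstarAlg (C : numClosedFieldType) := CStarAlg {
  cs_alg :> starAlgType C;
  cs_banach : completeNormedModType C;
  cs_vec : cs_alg -> cs_banach;
  cs_linear : linear cs_vec;
  cs_bij : bijective cs_vec;
  cs_submult : forall a b, `|cs_vec (a * b)| <= `|cs_vec a| * `|cs_vec b|;
  cs_identity : forall a, `|cs_vec (a^† * a)| = `|cs_vec a| ^+ 2
}.

Section HolomorphicCalculus.
Variable C : numClosedFieldType.

Definition spectrum (B : starAlgType C) (b : B) : set C^o :=
  [set z | ~ exists c, c * (b - z *: 1) = 1 /\ (b - z *: 1) * c = 1].

Definition holomorphic_on (U : set C^o) (f : C^o -> C^o) : Prop :=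
  forall z, U z -> derivable f z 1.

(* [Phi] is the holomorphic functional calculus of [b] on the open
   neighbourhood [U] of its spectrum: the unital algebra morphism
   [O(U) -> B] that sends the coordinate to [b] and is continuous for the
   compact-open topology of [O(U)] (a metrizable topology, so sequences
   suffice).  The continuity clause for constant sequences makes [Phi f]
   depend only on the restriction of [f] to [U]. *)
Definition holomorphic_calculus (B : cstarAlg C) (b : B) (U : set C^o)
    (Phi : (C^o -> C^o) -> B) : Prop :=
  [/\ Phi (fun=> 1) = 1 /\ Phi id = b,
      forall c f g, holomorphic_on U f -> holomorphic_on U g ->
        Phi (fun z => c * f z + g z) = c *: Phi f + Phi g,
      forall f g, holomorphic_on U f -> holomorphic_on U g ->
        Phi (fun z => f z * g z) = Phi f * Phi g
    & forall (u : nat -> C^o -> C^o) f,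
        (forall n, holomorphic_on U (u n)) -> holomorphic_on U f ->
        (forall K : set C^o, compact K -> K `<=` U ->
           {uniform K, u @ \oo --> f}) ->
        cs_vec (Phi (u n)) @[n --> \oo] --> cs_vec (Phi f)].

Definition holomorphically_stable (A : starAlgType C) : Prop :=
  exists (B : cstarAlg C) (j : A -> B),
  [/\ [/\ injective j, linear j, j 1 = 1,
          {morph j : a b / a * b} & {morph j : a / a^†}]
    & forall (a : A) (U : set C^o) (Phi : (C^o -> C^o) -> B),
        open U -> spectrum (j a) `<=` U ->
        holomorphic_calculus (j a) U Phi ->
        forall f, holomorphic_on U f -> exists a', Phi f = j a'].

End HolomorphicCalculus.

(** * Hilbert spaces and unbounded operators *)

(* The inner product is linear in its first argument. *)
Record hilbert (C : numClosedFieldType) := Hilbert {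
  hilb_space :> completeNormedModType C;
  ip : {dot hilb_space for Num.conj};
  ip_norm : forall x, `|x| ^+ 2 = ip x x
}.
Arguments ip {C h}.

Section Operators.
Variables (C : numClosedFieldType) (H : hilbert C).

Definition separable : Prop := exists S : set H, countable S /\ dense S.

Definition bounded_op (T : H -> H) : Prop :=
  linear T /\ exists M : C, forall x, `|T x| <= M * `|x|.

Definition compact_op (T : H -> H) : Prop :=
  bounded_op T /\ compact (closure (T @` [set x | `|x| <= 1])).

(* Unbounded operators are represented by their graphs: [D (x, y)] means that
   [x] belongs to the domain of [D] and [D x = y]. *)
Definition graph := set (H * H).

Definition dom (D : graph) : set H := [set x | exists y, D (x, y)].

Definition adjoint_graph (D : graph) : graph :=
  [set p | forall x y, D (x, y) -> ip y p.1 = ip x p.2].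

Definition self_adjoint (D : graph) : Prop :=
  dense (dom D) /\ D = adjoint_graph D.

(* [K = (D - z)^-1] *)
Definition is_resolvent (D : graph) (z : C) (K : H -> H) : Prop :=
  (forall x, D (K x, x + z *: K x)) /\
  (forall x y, D (x, y) -> K (y - z *: x) = x).

Definition compact_resolvent (D : graph) : Prop :=
  forall z : C, 'Im z != 0 -> exists2 K, is_resolvent D z K & compact_op K.

(* [T] is a bounded operator on [H] extending [[D, a]]; in particular [a]
   preserves the domain of [D]. *)
Definition extends_commutator (D : graph) (a T : H -> H) : Prop :=
  bounded_op T /\ forall x y, D (x, y) -> D (a x, a y + T x).

End Operators.

Definition lspan (C : numClosedFieldType) (V : lmodType C) (S : set V) : set V :=
  [set x | exists s : seq (C * V),
     (forall p, p \in s -> S p.2) /\ x = \sum_(p <- s) p.1 *: p.2].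

(** * Spectral triples *)

Record spectralTriple (C : numClosedFieldType) (A : starAlgType C) :=
  SpectralTriple {
  hilb :> hilbert C;
  rep : A -> hilb -> hilb;
  dirac : graph hilb;
  hilb_separable : separable hilb;
  rep_bounded : forall a, bounded_op (rep a);
  rep_linear : forall c a b x, rep (c *: a + b) x = c *: rep a x + rep b x;
  rep1 : forall x, rep 1 x = x;
  repM : forall a b x, rep (a * b) x = rep a (rep b x);
  rep_star : forall a x y, ip (rep a x) y = ip x (rep (a^†) y);
  rep_faithful : injective rep;
  dirac_self_adjoint : self_adjoint dirac;
  dirac_compact_resolvent : compact_resolvent dirac;
  dirac_commutator : forall a, exists T, extends_commutator dirac (rep a) T
}.

Arguments dirac {C A} s.

Record evenTriple (C : numClosedFieldType) (A : starAlgType C) := EvenTriple {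
  even_triple :> spectralTriple A;
  grading : even_triple -> even_triple;
  grading_bounded : bounded_op grading;
  grading_selfadjoint : forall x y, ip (grading x) y = ip x (grading y);
  gradingK : involutive grading;
  grading_rep : forall a x, grading (rep a x) = rep a (grading x);
  grading_dirac : forall x y, dirac even_triple (x, y) ->
    dirac even_triple (grading x, - grading y)
}.

(** ** One-forms *)

Section OneForms.
Variables (C : numClosedFieldType) (A : starAlgType C) (T : spectralTriple A).
Local Notation D := (dirac T).

(* the bounded extension of [[D, rep a]] *)
Definition commutator (a : A) : T -> T := sval (cid (dirac_commutator T a)).

Definition is_oneform (w : T -> T) : Prop :=
  exists s : seq (A * A),
    w = \sum_(p <- s) (rep p.1 \o commutator p.2 : T -> T).

Definition oneform_pred : {pred T -> T} := fun w => `[< is_oneform w >].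

Lemma commutatorP a : extends_commutator D (rep a) (commutator a).
Proof. by rewrite /commutator; case: cid. Qed.

Lemma bounded_opD (S S' : T -> T) : bounded_op S -> bounded_op S' ->
  bounded_op (fun x => S x + S' x).
Proof.
move=> [lS [M SM]] [lS' [M' SM']]; split.
  by move=> c x y; rewrite lS lS' scalerDr addrACA.
exists (M + M') => x; rewrite mulrDl; apply: (le_trans (ler_normD _ _)).
exact: lerD.
Qed.

Lemma bounded_opZ c (S : T -> T) : bounded_op S -> bounded_op (fun x => c *: S x).
Proof.
move=> [lS [M SM]]; split.
  by move=> d x y; rewrite lS scalerDr !scalerA [c * d]mulrC.
by exists (`|c| * M) => x; rewrite normrZ -mulrA ler_wpM2l.
Qed.

Lemma bounded_op_real (S : T -> T) : bounded_op S ->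
  exists2 M : C, 0 <= M & forall x, `|S x| <= M * `|x|.
Proof.
move=> [lS [M SM]]; have [[x x0]|H0] := pselect (exists x : T, x != 0).
  exists M => //; have := SM x => /(le_trans (normr_ge0 _)).
  by rewrite pmulr_lge0// normr_gt0.
exists 0 => // x; have x0 y : y = 0 :> T.
  by apply/eqP; apply: contrapT => y0; apply: H0; exists y; apply/negP.
by rewrite (x0 (S x)) normr0 mul0r.
Qed.

Lemma bounded_op_comp (S S' : T -> T) : bounded_op S -> bounded_op S' ->
  bounded_op (fun x => S (S' x)).
Proof.
move=> bS bS'; have [M M0 SM] := bounded_op_real bS.
have [[lS _] [lS' [M' SM']]] := (bS, bS').
split; first by move=> c x y; rewrite lS' lS.
exists (M * M') => x; apply: (le_trans (SM _)).
by rewrite -mulrA ler_wpM2l.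
Qed.

Lemma lin_sub (U V : lmodType C) (S : U -> V) : linear S -> forall x y, S (x - y) = S x - S y.
Proof.
by move=> lS x y; rewrite addrC -scaleN1r lS scaleN1r addrC.
Qed.


Lemma dense_zero (W : normedModType C) (X : set T) (g : T -> W) (M : C) :
  dense X -> (forall x y, g (x - y) = g x - g y) -> 0 <= M ->
  (forall x, `|g x| <= M * `|x|) -> (forall x, X x -> g x = 0) ->
  forall x, g x = 0.
Proof.
move=> dX gB M0 gM gX x; apply/eqP.
rewrite -normr_le0; apply/ler_addgt0Pl => e e0; rewrite addr0.
pose d := e / (M + 1).
have d0 : 0 < d by rewrite divr_gt0// ltr_wpDl.
have [y [xy Xy]] : ball x d `&` X !=set0.
  by apply: dX; [exists x; exact: ballxx|exact: ball_open].
have -> : g x = g (x - y) by rewrite gB (gX y)// subr0.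
apply: (le_trans (gM _)); move: xy; rewrite -ball_normE /ball_ /= => xy.
apply: (le_trans (ler_wpM2l M0 (ltW xy))).
by rewrite /d mulrCA ger_pMr// ler_pdivrMr ?mul1r ?ltr_wpDl// lerDl.
Qed.

Lemma bounded_op_dense (X : set T) (S S' : T -> T) :
  dense X -> bounded_op S -> bounded_op S' ->
  (forall x, X x -> S x = S' x) -> S = S'.
Proof.
move=> dX bS bS' SS'; apply/funext => x; apply/eqP; rewrite -subr_eq0.
pose R y := S y + -1 *: S' y.
have bR : bounded_op R by apply: bounded_opD => //; exact: bounded_opZ.
have [M M0 RM] := bounded_op_real bR.
rewrite -[- _]scaleN1r -/(R x); apply/eqP.
apply: (dense_zero dX (lin_sub (proj1 bR)) M0 RM) => y Xy.
by rewrite /R SS'// scaleN1r subrr.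
Qed.

Lemma ipDl (x y z : T) : ip (x + y) z = ip x z + ip y z.
Proof. by rewrite linearDl. Qed.
Lemma ipDr (x y z : T) : ip z (x + y) = ip z x + ip z y.
Proof. by rewrite linearDr. Qed.
Lemma ipZl c (x z : T) : ip (c *: x) z = c * ip x z.
Proof. by rewrite linearZl_LR. Qed.
Lemma ipZr c (x z : T) : ip z (c *: x) = c^* * ip z x.
Proof. by rewrite linearZr_LR. Qed.
Lemma ipNl (x z : T) : ip (- x) z = - ip x z.
Proof. by rewrite linearNl. Qed.
Lemma ipNr (x z : T) : ip z (- x) = - ip z x.
Proof. by rewrite linearNr. Qed.
Lemma ip0l (x : T) : ip 0 x = 0 :> C.
Proof. by rewrite linear0l. Qed.
Lemma ip0r (x : T) : ip x 0 = 0 :> C.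
Proof. by rewrite linear0r. Qed.
Lemma ipC (x y : T) : ip x y = (ip y x)^* :> C.
Proof. by rewrite hermC mul1r. Qed.

Lemma ip_ge0 (x : T) : 0 <= (ip x x : C).
Proof. by rewrite -ip_norm exprn_ge0. Qed.

Lemma ip_bound (x y : T) : `|ip x y : C| <= `|x| * `|y|.
Proof.
have [->|y0] := eqVneq y 0; first by rewrite ip0r !normr0 mulr0.
have n0 : 0 < ip y y :> C by rewrite -ip_norm exprn_gt0// normr_gt0.
set a : C := ip x y; set n : C := ip y y in n0.
have [w [wy xE]] : exists w : T, (ip w y = 0 :> C) /\ x = w + (a / n) *: y.
  exists (x - (a / n) *: y); rewrite subrK; split=> //.
  by rewrite ipDl ipNl ipZl -/a -/n divfK ?subrr// gt_eqF.
have yw : ip y w = 0 :> C by rewrite ipC wy conjC0.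
have xx : ip x x = ip w w + `|a| ^+ 2 / n :> C.
  rewrite xE ipDl !ipDr !ipZl !ipZr wy yw -/n !mulr0 addr0 add0r; congr (_ + _).
  rewrite rmorphM fmorphV /= (CrealP (gtr0_real n0)) normCK.
  by field; rewrite gt_eqF.
rewrite -(@ler_pXn2r _ 2)// ?nnegrE ?mulr_ge0// exprMn !ip_norm xx -/n.
by rewrite mulrDl divfK ?gt_eqF// lerDr mulr_ge0 ?ip_ge0// ltW.
Qed.

Lemma dense_ip0 (X : set T) (y : T) :
  dense X -> (forall x, X x -> ip x y = 0 :> C) -> y = 0.
Proof.
move=> dX Xy; suff : (ip y y : C) = 0.
  by move/eqP; rewrite -ip_norm expf_eq0/= normr_eq0 => /eqP.
pose g (x : T) : C^o := ip x y.
apply: (@dense_zero _ X g `|y|) => // [u v|x]; first by rewrite /g ipDl ipNl.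
by rewrite mulrC; exact: ip_bound.
Qed.

Lemma dirac_dense : dense (dom D).
Proof. by case: (dirac_self_adjoint T). Qed.

Lemma dirac_adj : D = adjoint_graph D.
Proof. by case: (dirac_self_adjoint T). Qed.

Lemma dirac_sym x y u v : D (x, y) -> D (u, v) -> ip y u = ip x v :> C.
Proof. by move=> Dxy; rewrite {1}dirac_adj => /(_ _ _ Dxy). Qed.

Lemma dirac_functional x y z : D (x, y) -> D (x, z) -> y = z.
Proof.
move=> Dxy Dxz; apply/eqP; rewrite -subr_eq0; apply/eqP.
apply: (dense_ip0 dirac_dense) => u [v Duv].
by rewrite ipDr ipNr -(dirac_sym Duv Dxy) -(dirac_sym Duv Dxz) subrr.
Qed.

Lemma commutator_unique a S :
  extends_commutator D (rep a) S -> S = commutator a.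
Proof.
move=> [bS DS]; have [bc Dc] := commutatorP a.
apply: (bounded_op_dense dirac_dense) => // x [y Dxy].
exact: (addrI (rep a y) (dirac_functional (DS _ _ Dxy) (Dc _ _ Dxy))).
Qed.

Lemma repD a x y : rep a (x + y) = rep a x + rep a y :> T.
Proof.
by have [l _] := rep_bounded T a; have := l 1 x y; rewrite !scale1r.
Qed.

Lemma commutatorM a b x :
  commutator (a * b) x = commutator a (rep b x) + rep a (commutator b x).
Proof.
have [[ba Da] [bb Db]] := (commutatorP a, commutatorP b).
pose S x := commutator a (rep b x) + rep a (commutator b x).
rewrite -(@commutator_unique _ S)//; split.
  by apply: bounded_opD; apply: bounded_op_comp => //; exact: rep_bounded.
move=> u v Duv; have := Da _ _ (Db _ _ Duv).
by rewrite !repM repD /S -addrA [_ (commutator b u) + _]addrC.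
Qed.

Lemma commutator_adj a x y :
  ip (commutator a x) y = - ip x (commutator (a^†) y) :> C.
Proof.
have [[[la ba] Da] [[lb bb] Db]] := (commutatorP a, commutatorP (a^†)).
have [M M0 aM] := bounded_op_real (conj la ba).
have [N N0 bN] := bounded_op_real (conj lb bb).
apply/eqP; rewrite -subr_eq0 opprK; apply/eqP.
pose g u v : C^o := ip (commutator a u) v + ip u (commutator (a^†) v).
rewrite -/(g x y).
have gbound u v : `|g u v| <= (M + N) * (`|u| * `|v|).
  apply: (le_trans (ler_normD _ _)); rewrite mulrDl; apply: lerD.
    apply: (le_trans (ip_bound _ _)); rewrite mulrA.
    by apply: ler_wpM2r.
  apply: (le_trans (ip_bound _ _)); rewrite mulrCA.
  by apply: ler_wpM2l.
have gBl u u' v : g (u - u') v = g u v - g u' v.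
  by rewrite /g (lin_sub la) !ipDl !ipNl opprD addrACA.
have gBr u v v' : g u (v - v') = g u v - g u v'.
  by rewrite /g (lin_sub lb) !ipDr !ipNr opprD addrACA.
apply: (@dense_zero _ (dom D) (g^~ y) ((M + N) * `|y|) dirac_dense) => //.
- by rewrite mulr_ge0// addr_ge0.
- by move=> u; rewrite -mulrA [`|y| * _]mulrC.
move=> u [u' Du].
apply: (@dense_zero _ (dom D) (g u) ((M + N) * `|u|) dirac_dense) => //.
- by rewrite mulr_ge0// addr_ge0.
- by move=> v; rewrite -mulrA.
move=> v [v' Dv]; rewrite /g.
have h1 := dirac_sym (Da _ _ Du) Dv.
have h2 := dirac_sym Du (Db _ _ Dv).
move: h1 h2; rewrite ipDl ipDr !rep_star => h1 h2.
have -> : ip (commutator a u) v = ip u (rep (a^†) v') - ip u' (rep (a^†) v) :> C.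
  by rewrite -h1 [_ + ip _ v]addrC addrK.
by rewrite h2 opprD addrA subrr add0r addrC subrr.
Qed.

Lemma is_oneform0 : is_oneform (0 : T -> T).
Proof. by exists [::]; rewrite big_nil. Qed.

Lemma is_oneformD w w' : is_oneform w -> is_oneform w' -> is_oneform (w + w').
Proof. by move=> [s ->] [s' ->]; exists (s ++ s'); rewrite big_cat. Qed.

Lemma is_oneform_gen a b : is_oneform (rep a \o commutator b).
Proof. by exists [:: (a, b)]; rewrite big_seq1. Qed.

Lemma is_oneform_ind (P : (T -> T) -> Prop) : P 0 ->
  (forall w w', P w -> P w' -> P (w + w')) ->
  (forall a b, P (rep a \o commutator b)) -> forall w, is_oneform w -> P w.
Proof.
by move=> P0 PD Pg w [s ->]; elim/big_ind: _ => // p _.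
Qed.

Lemma rep0 x : rep 0 x = 0 :> T.
Proof.
have /eqP := @rep_linear C A T 1 0 0 x; rewrite !scale1r addr0 eq_sym.
by rewrite -subr_eq0 addrK => /eqP.
Qed.

Lemma repN a x : rep (- a) x = - rep a x :> T.
Proof. by have := @rep_linear C A T (-1) a 0 x; rewrite rep0 !addr0 !scaleN1r. Qed.

Lemma rep_fun0 a : rep a 0 = 0 :> T.
Proof. by apply: (addrI (rep a 0)); rewrite -repD !addr0. Qed.

Lemma is_oneform_rep a w : is_oneform w -> is_oneform (rep a \o w).
Proof.
move: w; apply: is_oneform_ind => [|w w' iw iw'|b c].
- suff -> : rep a \o 0 = 0 :> (T -> T) by exact: is_oneform0.
  by apply/funext => x /=; exact: rep_fun0.
- suff -> : rep a \o (w + w') = (rep a \o w) + (rep a \o w') :> (T -> T).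
    exact: is_oneformD.
  by apply/funext => x; exact: repD.
- suff -> : rep a \o (rep b \o commutator c) = rep (a * b) \o commutator c.
    exact: is_oneform_gen.
  by apply/funext => x /=; rewrite repM.
Qed.

Lemma is_oneformZ (c : C) w : is_oneform w -> is_oneform (c *: w).
Proof.
move=> /(is_oneform_rep (c *: 1)); congr is_oneform; apply/funext => x /=.
by have := @rep_linear C A T c 1 0 (w x); rewrite addr0 rep0 addr0 rep1.
Qed.

Lemma is_oneform_comp w a : is_oneform w -> is_oneform (w \o rep a).
Proof.
move: w; apply: is_oneform_ind => [|w w' iw iw'|b c].
- exact: is_oneform0.
- exact: (is_oneformD iw iw').
- have -> : (rep b \o commutator c) \o rep a =
      (rep b \o commutator (c * a)) + (rep (- (b * c)) \o commutator a) :> (T -> T).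
    apply/funext => x /=; rewrite /GRing.add/= commutatorM repD repN repM addrK//.
  by apply: is_oneformD; exact: is_oneform_gen.
Qed.

Lemma is_oneform_adj w : is_oneform w ->
  exists2 w', is_oneform w' & forall x y, ip (w x) y = ip x (w' y) :> C.
Proof.
move: w; apply: is_oneform_ind => [|w w' [v iv hv] [v' iv' hv']|b c].
- exists 0; first exact: is_oneform0.
  by move=> x y; rewrite ip0l ip0r.
- exists (v + v'); first exact: is_oneformD.
  by move=> x y; rewrite ipDl ipDr hv hv'.
- exists ((-1 : C) *: (commutator (c^†) \o rep (b^†))).
    apply/is_oneformZ/is_oneform_comp.
    have -> : commutator (c^†) = rep 1 \o commutator (c^†).
      by apply/funext => x /=; rewrite rep1.
    exact: is_oneform_gen.
  move=> x y /=; rewrite rep_star commutator_adj.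
  by rewrite [in RHS]/GRing.scale/= scaleN1r ipNr.
Qed.

Lemma oneform_submod_closed : GRing.subsemimod_closed oneform_pred.
Proof.
split; first split.
- by apply/asboolP; exact: is_oneform0.
- by move=> w w' /asboolP iw /asboolP iw'; apply/asboolP; exact: is_oneformD.
- by move=> c w /asboolP iw; apply/asboolP; exact: is_oneformZ.
Qed.

Record oneform := OneForm {
  oneform_op :> T -> T;
  oneform_opP : oneform_op \in oneform_pred
}.
HB.instance Definition _ := [isSub for oneform_op].
HB.instance Definition _ := [Choice of oneform by <:].
HB.instance Definition _ := GRing.SubChoice_isSubLmodule.Build
  C (T -> T) oneform_pred oneform oneform_submod_closed.

End OneForms.

(** ** The bimodule structure, the differential and the star of one-forms *)

Arguments commutator {C A} T a.
Arguments commutatorP {C A} T a.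
Arguments is_oneform_gen {C A} T a b.
Arguments dirac_dense {C A} T.

Section OneFormStructure.
Variables (C : numClosedFieldType) (A : starAlgType C) (T : spectralTriple A).
Local Notation Om := (oneform T).

Lemma oneformP (w : Om) : is_oneform w.
Proof. exact/asboolP/(oneform_opP w). Qed.

Definition mk_oneform (w : T -> T) (h : is_oneform w) : Om :=
  OneForm (introT (asboolP _) h).

Definition form_lact (a : A) (w : Om) : Om :=
  mk_oneform (is_oneform_rep a (oneformP w)).

Definition form_ract (w : Om) (a : A) : Om :=
  mk_oneform (is_oneform_comp a (oneformP w)).

Lemma differential_subproof a : is_oneform (commutator T a).
Proof.
have -> : commutator T a = rep 1 \o commutator T a.
  by apply/funext => x /=; rewrite rep1.
exact: is_oneform_gen.
Qed.

Definition differential (a : A) : Om := mk_oneform (differential_subproof a).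

Lemma form_star_subproof (w : Om) :
  exists w' : Om, forall x y, ip (w x) y = ip x (w' y) :> C.
Proof. by have [w' iw' h] := is_oneform_adj (oneformP w); exists (mk_oneform iw'). Qed.

(* the operator adjoint *)
Definition form_star (w : Om) : Om := sval (cid (form_star_subproof w)).

Lemma form_lact_linear a : linear (form_lact a).
Proof.
move=> c w w'; apply: val_inj; apply/funext => x /=.
by have [l _] := rep_bounded T a; rewrite [LHS]l.
Qed.

HB.instance Definition _ a :=
  GRing.isLinear.Build C Om Om *:%R (form_lact a) (form_lact_linear a).

Definition lact_op (a : A) : {linear Om -> Om} := form_lact a.

End OneFormStructure.

Arguments differential {C A} T a.
Arguments lact_op {C A} T a.

(** * Hermitian modules *)

(* Right modules with an [A]-valued Hermitian form, antilinear in its first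
   argument; [hermitian_fgp] below adds finite projectivity and positivity. *)
Record hmod (C : numClosedFieldType) (A : starAlgType C) := Hmod {
  hm_space :> lmodType C;
  ract : hm_space -> A -> hm_space;
  hform : hm_space -> hm_space -> A;
  ract_linear : forall a, linear (ract^~ a);
  ract_linearr : forall x, linear (ract x);
  ract1 : forall x, ract x 1 = x;
  ractM : forall x a b, ract x (a * b) = ract (ract x a) b;
  hform_linear : forall x, linear (hform x);
  hform_ract : forall x y a, hform x (ract y a) = hform x y * a;
  hform_star : forall x y, (hform x y)^† = hform y x
}.

(* [E] is isometrically isomorphic to [p A^q] for a projection [p] of
   [M_q(A)], with [<xi, eta> = \sum_j xi_j^† eta_j]. *)
Definition hermitian_fgp (C : numClosedFieldType) (A : starAlgType C)
    (E : hmod A) : Prop :=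
  exists (q : nat) (p : 'M[A]_q) (phi : E -> 'cV[A]_q),
  [/\ p *m p = p, map_mx star p^T = p,
      [/\ injective phi, range phi = range (mulmx p),
          {morph phi : x y / x + y}
        & forall x a, phi (ract x a) = map_mx ( *%R^~ a) (phi x)]
    & forall x y, hform x y = \sum_(j < q) (phi x j 0)^† * phi y j 0].

Section Ract.
Variables (C : numClosedFieldType) (A : starAlgType C) (E : hmod A).

Definition ract_by (a : A) (x : E) : E := ract x a.

HB.instance Definition _ a :=
  GRing.isLinear.Build C E E *:%R (ract_by a) (ract_linear a).

Definition ract_op (a : A) : {linear E -> E} := ract_by a.

End Ract.
Arguments ract_op {C A} E a.

(** ** The Hermitian module [E1 (x) E2] over [A1 (x) A2] *)

Section TensorModule.
Variables (C : numClosedFieldType) (A1 A2 : starAlgType C).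
Variables (E1 : hmod A1) (E2 : hmod A2).
Local Notation E := (E1 ⊗ E2).

Definition tens_ract : E -> A1 ⊗ A2 -> E := tmap2 (@ract _ _ E1) (@ract _ _ E2).
Definition tens_hform : E -> E -> A1 ⊗ A2 :=
  tmap2 (@hform _ _ E1) (@hform _ _ E2).

Lemma linD (U V : lmodType C) (f : U -> V) :
  linear f -> forall x y, f (x + y) = f x + f y.
Proof. by move=> lf x y; have := lf 1 x y; rewrite !scale1r. Qed.

Lemma linZ (U V : lmodType C) (f : U -> V) :
  linear f -> forall c x, f (c *: x) = c *: f x.
Proof. by move=> lf c x; rewrite (scalable_linear lf). Qed.

Lemma ract_sesqui (B : starAlgType C) (F : hmod B) : sesqui id (@ract _ _ F).
Proof.
split=> *.
- exact: (linD (ract_linear _)).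
- exact: (linZ (ract_linear _)).
- exact: (linD (ract_linearr _)).
- exact: (linZ (ract_linearr _)).
Qed.

Lemma hform_sesqui (B : starAlgType C) (F : hmod B) :
  sesqui Num.conj (@hform _ _ F).
Proof.
split=> *.
- by rewrite -hform_star (linD (hform_linear _)) starD !hform_star.
- by rewrite -hform_star (linZ (hform_linear _)) starZ hform_star.
- exact: (linD (hform_linear _)).
- exact: (linZ (hform_linear _)).
Qed.

Let rS1 := ract_sesqui E1.
Let rS2 := ract_sesqui E2.
Let hS1 := hform_sesqui E1.
Let hS2 := hform_sesqui E2.

Lemma tens_ract_tens e1 e2 a1 a2 :
  tens_ract (tens e1 e2) (tens a1 a2) = tens (ract e1 a1) (ract e2 a2).
Proof. exact: (tmap2_tens rS1 rS2). Qed.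

Lemma tens_hform_tens e1 e2 f1 f2 :
  tens_hform (tens e1 e2) (tens f1 f2) = tens (hform e1 f1) (hform e2 f2).
Proof. exact: (tmap2_tens hS1 hS2). Qed.

Lemma tens_ract_linear a : linear (tens_ract^~ a).
Proof.
move=> c x y; rewrite /tens_ract (tmap2Dl rS1 rS2); congr (_ + _).
exact: (tmap2Zl rS1 rS2).
Qed.

Lemma tens_ract_linearr x : linear (tens_ract x).
Proof.
move=> c a b; rewrite /tens_ract (tmap2Dr rS1 rS2); congr (_ + _).
exact: (tmap2Zr rS1 rS2).
Qed.

Lemma tens_hform_linear x : linear (tens_hform x).
Proof.
move=> c a b; rewrite /tens_hform (tmap2Dr hS1 hS2); congr (_ + _).
exact: (tmap2Zr hS1 hS2).
Qed.

Let ractDl x y a : tens_ract (x + y) a = tens_ract x a + tens_ract y a.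
Proof. exact: (tmap2Dl rS1 rS2). Qed.
Let ractDr x a b : tens_ract x (a + b) = tens_ract x a + tens_ract x b.
Proof. exact: (tmap2Dr rS1 rS2). Qed.
Let ract0l a : tens_ract 0 a = 0. Proof. exact: (tmap20l rS1 rS2). Qed.
Let ract0r x : tens_ract x 0 = 0. Proof. exact: (tmap20r rS1 rS2). Qed.
Let hformDl x y z : tens_hform (x + y) z = tens_hform x z + tens_hform y z.
Proof. exact: (tmap2Dl hS1 hS2). Qed.
Let hformDr x y z : tens_hform x (y + z) = tens_hform x y + tens_hform x z.
Proof. exact: (tmap2Dr hS1 hS2). Qed.
Let hform0l a : tens_hform 0 a = 0. Proof. exact: (tmap20l hS1 hS2). Qed.
Let hform0r x : tens_hform x 0 = 0. Proof. exact: (tmap20r hS1 hS2). Qed.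

Lemma tens_ract1 x : tens_ract x 1 = x.
Proof.
elim/tensor_ind: x => [|e1 e2|x y IH IH']; first by rewrite ract0l.
  by rewrite [LHS]tens_ract_tens !ract1.
by rewrite ractDl IH IH'.
Qed.

Lemma tens_ractM x a b : tens_ract x (a * b) = tens_ract (tens_ract x a) b.
Proof.
elim/tensor_ind: x => [|e1 e2|x y IH IH']; first by rewrite !ract0l.
  elim/tensor_ind: a => [|a1 a2|a a' IH IH'].
  - by rewrite mul0r !ract0r ract0l.
  - elim/tensor_ind: b => [|b1 b2|b b' IH IH'].
    + by rewrite mulr0 !ract0r.
    + rewrite [_ * _]tmul_tens !tens_ract_tens !ractM//.
    + by rewrite mulrDr !ractDr IH IH'.
  - by rewrite mulrDl !ractDr IH IH' ractDl.
by rewrite !ractDl IH IH'.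
Qed.

Lemma tens_hform_ract x y a : tens_hform x (tens_ract y a) = tens_hform x y * a.
Proof.
elim/tensor_ind: x => [|e1 e2|x x' IH IH']; first by rewrite !hform0l mul0r.
  elim/tensor_ind: y => [|f1 f2|y y' IH IH'].
  - by rewrite ract0l hform0r mul0r.
  - elim/tensor_ind: a => [|a1 a2|a a' IH IH'].
    + by rewrite ract0r hform0r mulr0.
    + by rewrite tens_ract_tens !tens_hform_tens [RHS]tmul_tens !hform_ract.
    + by rewrite ractDr hformDr IH IH' mulrDr.
  - by rewrite ractDl !hformDr IH IH' mulrDl.
by rewrite !hformDl IH IH' mulrDl.
Qed.

Lemma tens_hform_star x y : (tens_hform x y)^† = tens_hform y x.
Proof.
have star0 : (0 : A1 ⊗ A2)^† = 0 by exact: tstar0.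
elim/tensor_ind: x => [|e1 e2|x x' IH IH']; first by rewrite hform0l hform0r star0.
  elim/tensor_ind: y => [|f1 f2|y y' IH IH'].
  - by rewrite hform0l hform0r star0.
  - by rewrite !tens_hform_tens [LHS]tstar_tens !hform_star.
  - by rewrite hformDl hformDr starD IH IH'.
by rewrite hformDl hformDr starD IH IH'.
Qed.

Definition hmod_tens : hmod (A1 ⊗ A2) :=
  Hmod tens_ract_linear tens_ract_linearr tens_ract1 tens_ractM
       tens_hform_linear tens_hform_ract tens_hform_star.

End TensorModule.

(** * Compatible connections *)

Section Connections.
Variables (C : numClosedFieldType) (A : starAlgType C) (T : spectralTriple A).
Variable E : hmod A.

(* [E (x)_A Omega^1_D(A)] *)
Definition formsE := tensor (ract_op E) (lact_op T).
HB.instance Definition _ := GRing.Lmodule.on formsE.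

(* [(xi (x) w) a = xi (x) w a] *)
Definition formsE_ract (z : formsE) (a : A) : formsE :=
  tlift (fun xi w => (tens xi (form_ract w a) : formsE)) z.

(* [<eta, xi (x) w> = <eta, xi> w] *)
Definition pairing_r (eta : E) (z : formsE) : oneform T :=
  tlift (fun xi w => form_lact (hform eta xi) w) z.

(* [<xi (x) w, eta> = w^* <xi, eta>] *)
Definition pairing_l (z : formsE) (eta : E) : oneform T :=
  tlift (fun xi w => form_ract (form_star w) (hform xi eta)) z.

Definition is_connection (nabla : E -> formsE) : Prop :=
  linear nabla /\
  forall xi a, nabla (ract xi a) =
    formsE_ract (nabla xi) a + tens xi (differential T a).

Definition compatible_connection (nabla : E -> formsE) : Prop :=
  is_connection nabla /\
  forall xi eta, pairing_r xi (nabla eta) - pairing_l (nabla xi) eta =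
    differential T (hform xi eta).

End Connections.

(** * Product triples *)

(* [H], with the bilinear map [t], is the Hilbert space tensor product of
   [H1] and [H2]; this determines [(H, t)] up to a unique unitary. *)
Definition hilbert_tensor (C : numClosedFieldType) (H1 H2 H : hilbert C)
    (t : H1 -> H2 -> H) : Prop :=
  [/\ forall x2, linear (t^~ x2), forall x1, linear (t x1),
      forall x1 x2 y1 y2, ip (t x1 x2) (t y1 y2) = ip x1 y1 * ip x2 y2 :> C
    & dense (lspan [set z | exists x1 x2, z = t x1 x2])].

(* [T] is the product of [T1] and [T2]:
   [D = D1 (x) 1 + gamma1 (x) D2] is the closure of its restriction to the
   algebraic tensor product of the domains of [D1] and [D2]. *)
Record is_product (C : numClosedFieldType) (A1 A2 : starAlgType C)
    (T1 : evenTriple A1) (T2 : evenTriple A2) (T : evenTriple (A1 ⊗ A2))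
    (t : T1 -> T2 -> T) : Prop := IsProduct {
  prod_hilb : hilbert_tensor t;
  prod_rep : forall a1 a2 x1 x2,
    rep (tens a1 a2 : A1 ⊗ A2) (t x1 x2) = t (rep a1 x1) (rep a2 x2);
  prod_dirac : dirac T = closure (lspan
    [set p | exists x1 y1 x2 y2, [/\ dirac T1 (x1, y1), dirac T2 (x2, y2)
      & p = (t x1 x2, t y1 x2 + t (grading x1) y2)]]);
  prod_grading : forall x1 x2, grading (t x1 x2) = t (grading x1) (grading x2)
}.

Section ProductForms.
Variables (C : numClosedFieldType) (A1 A2 : starAlgType C).
Variables (T1 : evenTriple A1) (T2 : evenTriple A2) (T : evenTriple (A1 ⊗ A2)).
Variable t : T1 -> T2 -> T.

(* The one-form [w1 (x) a2]; [form1P] and [form2P] show that the forms chosen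
   here exist when [t] exhibits [T] as the product of [T1] and [T2]. *)
Definition form1 (w1 : oneform T1) (a2 : A2) : oneform T :=
  xget 0 [set w : oneform T | forall x1 x2, w (t x1 x2) = t (w1 x1) (rep a2 x2)].

(* The one-form [gamma1 a1 (x) w2]. *)
Definition form2 (a1 : A1) (w2 : oneform T2) : oneform T :=
  xget 0 [set w : oneform T |
    forall x1 x2, w (t x1 x2) = t (grading (rep a1 x1)) (w2 x2)].

Hypothesis hT : is_product t.

Lemma prodDl x y x2 : t (x + y) x2 = t x x2 + t y x2.
Proof. by have [[l _ _ _] _ _ _] := hT; exact: (linD (l x2)). Qed.
Lemma prodDr x1 x y : t x1 (x + y) = t x1 x + t x1 y.
Proof. by have [[_ l _ _] _ _ _] := hT; exact: (linD (l x1)). Qed.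
Lemma prod0l x2 : t 0 x2 = 0.
Proof. by apply: (addrI (t 0 x2)); rewrite -prodDl !addr0. Qed.
Lemma prod0r x1 : t x1 0 = 0.
Proof. by apply: (addrI (t x1 0)); rewrite -prodDr !addr0. Qed.
Lemma prodBl x y x2 : t (x - y) x2 = t x x2 - t y x2.
Proof. by have [[l _ _ _] _ _ _] := hT; exact: (lin_sub (l x2)). Qed.
Lemma prodBr x1 x y : t x1 (x - y) = t x1 x - t x1 y.
Proof. by have [[_ l _ _] _ _ _] := hT; exact: (lin_sub (l x1)). Qed.

Lemma prod_norm x1 x2 : `|t x1 x2| = `|x1| * `|x2|.
Proof.
have [[_ _ tip _] _ _ _] := hT.
apply/eqP; rewrite -(@eqrXn2 _ 2)// ?mulr_ge0//.
by rewrite exprMn !ip_norm tip.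
Qed.

Lemma prod_dirac_gen x1 y1 x2 y2 : dirac T1 (x1, y1) -> dirac T2 (x2, y2) ->
  dirac T (t x1 x2, t y1 x2 + t (grading x1) y2).
Proof.
move=> D1 D2; rewrite (prod_dirac hT); apply: subset_closure.
exists [:: (1, (t x1 x2, t y1 x2 + t (grading x1) y2))].
split; last by rewrite big_seq1 scale1r.
by move=> p; rewrite inE => /eqP -> /=; exists x1, y1, x2, y2.
Qed.

Lemma prod_dense (S : T -> T) (S1 : T1 -> T1) (S2 : T2 -> T2) :
  bounded_op S -> bounded_op S1 -> bounded_op S2 ->
  (forall x1 x2, dom (dirac T1) x1 -> dom (dirac T2) x2 ->
     S (t x1 x2) = t (S1 x1) (S2 x2)) ->
  forall x1 x2, S (t x1 x2) = t (S1 x1) (S2 x2).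
Proof.
move=> bS bS1 bS2 h x1 x2.
have [lS _] := bS; have [lS1 _] := bS1; have [lS2 _] := bS2.
have [M M0 SM] := bounded_op_real bS.
have [N N0 SN] := bounded_op_real bS1; have [P P0 SP] := bounded_op_real bS2.
pose g u v := S (t u v) - t (S1 u) (S2 v).
apply/eqP; rewrite -subr_eq0; apply/eqP; rewrite -/(g x1 x2).
have gb u v : `|g u v| <= (M + N * P) * (`|u| * `|v|).
  apply: (le_trans (ler_normB _ _)); rewrite mulrDl prod_norm; apply: lerD.
    by rewrite -prod_norm.
  by rewrite mulrACA; apply: ler_pM.
have gBl u u' v : g (u - u') v = g u v - g u' v.
  rewrite /g (lin_sub lS1) !prodBl (lin_sub lS) !opprB [LHS]addrACA [RHS]addrACA; congr (_ + _);
     exact: addrC.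
have gBr u v v' : g u (v - v') = g u v - g u v'.
  rewrite /g (lin_sub lS2) !prodBr (lin_sub lS) !opprB [LHS]addrACA [RHS]addrACA; congr (_ + _);
     exact: addrC.
have K0 : 0 <= M + N * P by rewrite addr_ge0// mulr_ge0.
apply: (@dense_zero _ _ T1 _ (dom (dirac T1)) (g^~ x2)
  ((M + N * P) * `|x2|) (dirac_dense T1)) => //.
- by rewrite mulr_ge0.
- by move=> u; rewrite -mulrA [`|x2| * _]mulrC.
move=> u du; apply: (@dense_zero _ _ T2 _ (dom (dirac T2)) (g u)
  ((M + N * P) * `|u|) (dirac_dense T2)) => //.
- by rewrite mulr_ge0.
- by move=> v; rewrite -mulrA.
by move=> v dv; rewrite /g h// subrr.
Qed.

Lemma id_bounded (B : starAlgType C) (S : spectralTriple B) :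
  bounded_op (fun x : S => x).
Proof. by split=> //; exists 1 => x; rewrite mul1r. Qed.

Lemma prod_commutator1 b x1 x2 :
  commutator T (tens b 1 : A1 ⊗ A2) (t x1 x2) = t (commutator T1 b x1) x2.
Proof.
have [bc Dc] := commutatorP T (tens b 1 : A1 ⊗ A2).
have [b1 D1] := commutatorP T1 b.
apply: (@prod_dense (commutator T (tens b 1 : A1 ⊗ A2)) (commutator T1 b) (fun x => x)) => //.
  exact: id_bounded.
move=> {}x1 {}x2 [y1 Dx1] [y2 Dx2].
have := Dc _ _ (prod_dirac_gen Dx1 Dx2).
rewrite (prod_rep hT) rep1 => /dirac_functional -/(_ _ (prod_dirac_gen (D1 _ _ Dx1) Dx2)).
rewrite repD !(prod_rep hT) !rep1 prodDl grading_rep -!addrA => /addrI.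
by rewrite addrC => /addIr.
Qed.

Lemma prod_commutator2 b x1 x2 :
  commutator T (tens 1 b : A1 ⊗ A2) (t x1 x2) = t (grading x1) (commutator T2 b x2).
Proof.
have [bc Dc] := commutatorP T (tens 1 b : A1 ⊗ A2).
have [b2 D2] := commutatorP T2 b.
apply: (@prod_dense (commutator T (tens 1 b : A1 ⊗ A2)) (@grading _ _ T1) (commutator T2 b)) => //.
  exact: grading_bounded.
move=> {}x1 {}x2 [y1 Dx1] [y2 Dx2].
have := Dc _ _ (prod_dirac_gen Dx1 Dx2).
rewrite (prod_rep hT) rep1 => /dirac_functional -/(_ _ (prod_dirac_gen Dx1 (D2 _ _ Dx2))).
by rewrite repD !(prod_rep hT) !rep1 prodDr addrA => /addrI.
Qed.

Lemma form1P w1 a2 x1 x2 : form1 w1 a2 (t x1 x2) = t (w1 x1) (rep a2 x2).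
Proof.
suff : exists w : oneform T, forall x1 x2, w (t x1 x2) = t (w1 x1) (rep a2 x2).
  by move=> /(@xgetPex _ 0 [set w : oneform T | forall x1 x2, _]); exact.
have := oneformP w1; move: (oneform_op w1).
apply: is_oneform_ind => [|w w' [v hv] [v' hv']|a b].
- by exists 0 => u v; rewrite [RHS]prod0l.
- by exists (v + v') => u u'; rewrite [RHS]prodDl -hv -hv'.
- exists (mk_oneform (is_oneform_gen T (tens a a2 : A1 ⊗ A2) (tens b 1 : A1 ⊗ A2))) => u v /=.
  by rewrite prod_commutator1 (prod_rep hT).
Qed.

Lemma form2P a1 w2 x1 x2 :
  form2 a1 w2 (t x1 x2) = t (grading (rep a1 x1)) (w2 x2).
Proof.
suff : exists w : oneform T,
    forall x1 x2, w (t x1 x2) = t (grading (rep a1 x1)) (w2 x2).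
  by move=> /(@xgetPex _ 0 [set w : oneform T | forall x1 x2, _]); exact.
have := oneformP w2; move: (oneform_op w2).
apply: is_oneform_ind => [|w w' [v hv] [v' hv']|a b].
- by exists 0 => u v; rewrite [RHS]prod0r.
- by exists (v + v') => u u'; rewrite [RHS]prodDr -hv -hv'.
- exists (mk_oneform (is_oneform_gen T (tens a1 a : A1 ⊗ A2) (tens 1 b : A1 ⊗ A2))) => u v /=.
  by rewrite prod_commutator2 (prod_rep hT) grading_rep.
Qed.

End ProductForms.

(** ** The canonical maps into [E (x)_A Omega^1_D(A)] *)

Section ProductConnection.
Variables (C : numClosedFieldType) (A1 A2 : starAlgType C).
Variables (T1 : evenTriple A1) (T2 : evenTriple A2) (T : evenTriple (A1 ⊗ A2)).
Variable t : T1 -> T2 -> T.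
Variables (E1 : hmod A1) (E2 : hmod A2).
Local Notation EOm := (formsE T (hmod_tens E1 E2)).

(* [(e1 (x) w1) (x) e2 |-> (e1 (x) e2) (x) (w1 (x) 1)] *)
Definition iota1 (z : formsE T1 E1 ⊗ E2) : EOm :=
  tlift (fun z1 e2 =>
    tlift (fun e1 w1 =>
      (tens (tens e1 e2 : hmod_tens E1 E2) (form1 t w1 1) : EOm)) z1) z.

(* [e1 (x) (e2 (x) w2) |-> (e1 (x) e2) (x) (gamma1 (x) w2)] *)
Definition iota2 (z : E1 ⊗ formsE T2 E2) : EOm :=
  tlift (fun e1 z2 =>
    tlift (fun e2 w2 =>
      (tens (tens e1 e2 : hmod_tens E1 E2) (form2 t 1 w2) : EOm)) z2) z.

End ProductConnection.

(* Main.v *)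
Require Import Defs.
From mathcomp Require Import all_boot all_order all_algebra complex.
From mathcomp Require Import all_classical all_reals all_analysis.

Set Implicit Arguments.
Unset Strict Implicit.
Unset Printing Implicit Defensive.

Import Num.Theory GRing.Theory.
Local Open Scope ring_scope.

(** Every term of the Leibniz rule and of the compatibility equation is additive
    in its module arguments and in the algebra argument, so both identities need
    only be checked on elementary tensors.  There they reduce to the identities
    for [nabla1] and [nabla2] through a small calculus of one-forms on the
    product triple.

    In that calculus a one-form is determined by its values on the vectors
    [t x1 x2], whose span is dense ([oneform_prodP]).  Comparing values gives
    the bimodule structure: [A1 ⊗ A2] acts on the forms [w1 (x) a2] and
    [gamma1 a1 (x) w2] factor by factor ([form1_lact], [form1_ract],
    [form2_lact], [form2_ract]).  No sign appears, because [gamma1] commutes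
    with [A1] and only ever meets elements of [A1].  The star is also computed
    factor by factor ([form1_star], [form2_star]), [gamma1] being self-adjoint.
    Finally the differential splits ([differential_tens]):
    [d (a1 (x) a2) = d1 a1 (x) a2 + gamma1 a1 (x) d2 a2].

    The canonical maps [iota1] and [iota2] then intertwine the right actions
    ([iota1_ract], [iota2_ract]) and the pairings ([pairing_r_iota1],
    [pairing_l_iota1], [pairing_r_iota2], [pairing_l_iota2]).  Writing
    [b1 = <e1, f1>] and [b2 = <e2, f2>], the left-hand side of the compatibility
    equation at [e1 (x) e2] and [f1 (x) f2] becomes
    [d1 b1 (x) b2 + gamma1 b1 (x) d2 b2], which is [d (b1 (x) b2)].

    The connection exists because its formula on elementary tensors is balanced
    over the scalars, and it is unique because those tensors span. *)

(** * Preliminaries on stars and tensors *)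

Lemma star1 (C : numClosedFieldType) (A : starAlgType C) : (1 : A)^† = 1.
Proof. by rewrite -[RHS]starK -[in RHS](mulr1 (1^†)) starM starK mulr1. Qed.

Lemma tlift_linear (C : numClosedFieldType) (U V W : lmodType C) (I : Type)
    (r : I -> {linear U -> U}) (l : I -> {linear V -> V}) (f : U -> V -> W) :
  balanced r l f -> (forall c u v, f (c *: u) v = c *: f u v) ->
  linear (tlift f : tensor r l -> W).
Proof.
move=> hf fZ c x y; rewrite (tliftD hf); congr (_ + _).
rewrite [LHS](tlift_scale c x hf) !tliftE scaler_sumr.
by apply: eq_bigr => p _; rewrite fZ.
Qed.

Lemma tens0l (C : numClosedFieldType) (U V : lmodType C) (v : V) : (tens 0 v : U ⊗ V) = 0.
Proof. exact: balanced0l (tens_balanced _ _). Qed.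

Lemma tens0r (C : numClosedFieldType) (U V : lmodType C) (u : U) : (tens u 0 : U ⊗ V) = 0.
Proof. by apply: (addrI (tens u 0 : U ⊗ V)); rewrite -tensDr !addr0. Qed.

(** * Bimodule structure, star and differential of one-forms *)

Section OneForms.
Variables (C : numClosedFieldType) (A : starAlgType C) (T : spectralTriple A).
Implicit Types (w v : oneform T) (a b : A).

(** Linearity of the operator makes the right action additive in the algebra
    element, the algebra acting before the form does. *)
Lemma oneform_linear w : linear w.
Proof.
have := oneformP w; move: (oneform_op w).
apply: is_oneform_ind => [|u u' lu lu'|a b] c x y.
- by rewrite scaler0 addr0.
- have -> z : (u + u') z = u z + u' z by [].
  by rewrite lu lu' scalerDr addrACA.
- have [lb _] := (commutatorP T b).1; have [la _] := rep_bounded T a.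
  by rewrite /= lb la.
Qed.

Lemma oneform_funP w v : (forall x, w x = v x) -> w = v.
Proof. by move=> h; apply: val_inj; apply/funext. Qed.

Lemma add_formE w v x : (w + v) x = w x + v x.
Proof. by []. Qed.

Lemma scale_formE (c : C) w x : (c *: w) x = c *: w x.
Proof. by []. Qed.

Lemma ip_inj (y z : T) : (forall x : T, ip x y = ip x z :> C) -> y = z.
Proof.
move=> h; apply/eqP; rewrite -subr_eq0; apply/eqP.
apply: (dense_ip0 (dirac_dense T)) => x _.
by rewrite ipDr ipNr h subrr.
Qed.

Lemma form_starE w x y : ip (w x) y = ip x (form_star w y) :> C.
Proof. by rewrite /form_star; case: cid => v hv; exact: hv. Qed.

Lemma form_star_unique w v :
  (forall x y, ip (w x) y = ip x (v y) :> C) -> form_star w = v.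
Proof.
by move=> h; apply: oneform_funP => y; apply: ip_inj => x; rewrite -form_starE.
Qed.

Lemma form_starK w : form_star (form_star w) = w.
Proof.
by apply: form_star_unique => x y; rewrite ipC -form_starE -ipC.
Qed.

Lemma form_star_inj : injective (@form_star _ _ T).
Proof. exact: can_inj form_starK. Qed.

Lemma form_starD w v : form_star (w + v) = form_star w + form_star v.
Proof.
apply: form_star_unique => x y.
by rewrite !add_formE ipDl ipDr !form_starE.
Qed.

Lemma form_starZ (c : C) w : form_star (c *: w) = c^* *: form_star w.
Proof.
apply: form_star_unique => x y.
by rewrite !scale_formE ipZl ipZr conjCK form_starE.
Qed.

(** Since [(a w)^* = w^* a^*], this is what makes the left pairing balanced over
    the algebra. *)
Lemma form_star_lact a w :
  form_star (form_lact a w) = form_ract (form_star w) (a^†).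
Proof. by apply: form_star_unique => x y; rewrite /= rep_star form_starE. Qed.

Lemma repZ (c : C) a (x : T) : rep (c *: a) x = c *: rep a x.
Proof. by rewrite -[c *: a]addr0 rep_linear rep0 addr0. Qed.

Lemma rep_sum (a b : A) (x : T) : rep (a + b) x = rep a x + rep b x.
Proof. by rewrite -[a]scale1r rep_linear !scale1r. Qed.

Lemma form_lactDr a w v : form_lact a (w + v) = form_lact a w + form_lact a v.
Proof. exact: (linD (form_lact_linear (T := T) a)). Qed.

Lemma form_lactZr (c : C) a w : form_lact a (c *: w) = c *: form_lact a w.
Proof. exact: (linZ (form_lact_linear (T := T) a)). Qed.

Lemma form_lactDl a b w : form_lact (a + b) w = form_lact a w + form_lact b w.
Proof. by apply: oneform_funP => x; exact: rep_sum. Qed.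

Lemma form_lactZl (c : C) a w : form_lact (c *: a) w = c *: form_lact a w.
Proof. by apply: oneform_funP => x; exact: repZ. Qed.

Lemma form_lactM a b w : form_lact (a * b) w = form_lact a (form_lact b w).
Proof. by apply: oneform_funP => x /=; rewrite repM. Qed.

Lemma form_lact1 w : form_lact 1 w = w.
Proof. by apply: oneform_funP => x /=; rewrite rep1. Qed.

Lemma form_ractDl w v a : form_ract (w + v) a = form_ract w a + form_ract v a.
Proof. exact: oneform_funP. Qed.

Lemma form_ractZl (c : C) w a : form_ract (c *: w) a = c *: form_ract w a.
Proof. exact: oneform_funP. Qed.

Lemma form_ractDr w a b : form_ract w (a + b) = form_ract w a + form_ract w b.
Proof.
apply: oneform_funP => x /=; rewrite rep_sum.
exact: (linD (oneform_linear w)).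
Qed.

Lemma form_ractZr (c : C) w a : form_ract w (c *: a) = c *: form_ract w a.
Proof.
apply: oneform_funP => x /=; rewrite repZ.
exact: (linZ (oneform_linear w)).
Qed.

Lemma form_ractM w a b : form_ract w (a * b) = form_ract (form_ract w a) b.
Proof. by apply: oneform_funP => x /=; rewrite repM. Qed.

Lemma form_lact_ract a w b :
  form_lact a (form_ract w b) = form_ract (form_lact a w) b.
Proof. exact: oneform_funP. Qed.

(** The graph of a self-adjoint operator is the graph of its adjoint, a condition
    preserved by sums of pairs. *)
Lemma dirac_add (x y x' y' : T) :
  Defs.dirac T (x, y) -> Defs.dirac T (x', y') -> Defs.dirac T (x + x', y + y').
Proof.
rewrite dirac_adj => Dxy Dxy' u v Duv /=.
by rewrite !ipDr (Dxy u v Duv) (Dxy' u v Duv).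
Qed.

(** The sum of the two commutators extends the commutator of the sum, because
    the graph of the Dirac operator is closed under addition. *)
Lemma differentialD a b :
  differential T (a + b) = differential T a + differential T b.
Proof.
apply: val_inj; apply/esym/commutator_unique.
have [bda Da] := commutatorP T a; have [bdb Db] := commutatorP T b.
split; first exact: (bounded_opD bda bdb).
move=> x y Dxy; rewrite !rep_sum addrACA.
exact: dirac_add (Da _ _ Dxy) (Db _ _ Dxy).
Qed.

Lemma differential0 : differential T 0 = 0.
Proof. by apply: (addrI (differential T 0)); rewrite -differentialD !addr0. Qed.

Lemma differentialM a b :
  differential T (a * b) =
    form_ract (differential T a) b + form_lact a (differential T b).
Proof. by apply: oneform_funP => x; exact: commutatorM. Qed.

End OneForms.

(** * Pairings with module-valued one-forms *)

Section Pairings.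
Variables (C : numClosedFieldType) (A : starAlgType C) (T : spectralTriple A).
Variable E : hmod A.
Implicit Types (xi eta : E) (z : formsE T E) (w : oneform T) (a b : A).

Lemma hformDl xi xi' eta : hform (xi + xi') eta = hform xi eta + hform xi' eta.
Proof. by have [h _ _ _] := hform_sesqui E. Qed.

Lemma hformZl (c : C) xi eta : hform (c *: xi) eta = c^* *: hform xi eta.
Proof. by have [_ h _ _] := hform_sesqui E. Qed.

Lemma hformDr xi eta eta' : hform xi (eta + eta') = hform xi eta + hform xi eta'.
Proof. by have [_ _ h _] := hform_sesqui E. Qed.

Lemma hformZr (c : C) xi eta : hform xi (c *: eta) = c *: hform xi eta.
Proof. by have [_ _ _ h] := hform_sesqui E. Qed.

Lemma hform0l eta : hform 0 eta = 0.
Proof. by apply: (addrI (hform 0 eta)); rewrite -hformDl !addr0. Qed.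

Lemma hform0r xi : hform xi 0 = 0.
Proof. by apply: (addrI (hform xi 0)); rewrite -hformDr !addr0. Qed.

Lemma hform_ractl xi eta a : hform (ract xi a) eta = a^† * hform xi eta.
Proof. by rewrite -hform_star hform_ract starM hform_star. Qed.

Lemma pairing_r_balanced eta : balanced (ract_op E) (lact_op T)
  (fun xi w => form_lact (hform eta xi) w).
Proof.
split=> [u u' v|u v v'|c u v|a u v].
- by rewrite hformDr form_lactDl.
- exact: form_lactDr.
- by rewrite hformZr form_lactZl form_lactZr.
- by rewrite /= /ract_by hform_ract form_lactM.
Qed.

Lemma pairing_l_balanced eta : balanced (ract_op E) (lact_op T)
  (fun xi w => form_ract (form_star w) (hform xi eta)).
Proof.
split=> [u u' v|u v v'|c u v|a u v].
- by rewrite hformDl form_ractDr.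
- by rewrite form_starD form_ractDl.
- by rewrite hformZl form_starZ form_ractZl form_ractZr.
- by rewrite /= /ract_by hform_ractl form_ractM form_star_lact.
Qed.

Lemma formsE_ract_balanced a : balanced (ract_op E) (lact_op T)
  (fun xi w => tens xi (form_ract w a) : formsE T E).
Proof.
split=> [u u' v|u v v'|c u v|b u v].
- by rewrite tensDl.
- by rewrite form_ractDl tensDr.
- by rewrite form_ractZl tensZl tensZr.
- by rewrite tens_act /= form_lact_ract.
Qed.

Lemma pairing_r_tens eta xi w :
  pairing_r eta (tens xi w : formsE T E) = form_lact (hform eta xi) w.
Proof. exact: tlift_tens (pairing_r_balanced eta). Qed.

Lemma pairing_rDr eta z z' :
  pairing_r eta (z + z') = pairing_r eta z + pairing_r eta z'.
Proof. exact: tliftD (pairing_r_balanced eta) z z'. Qed.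

Lemma pairing_r0r eta : pairing_r eta (0 : formsE T E) = 0.
Proof. exact: tlift0 (pairing_r_balanced eta). Qed.

Lemma pairing_rDl eta eta' z :
  pairing_r (eta + eta') z = pairing_r eta z + pairing_r eta' z.
Proof.
rewrite /pairing_r !tliftE -big_split; apply: eq_bigr => p _ /=.
by rewrite hformDl form_lactDl.
Qed.

Lemma pairing_r0l z : pairing_r 0 z = 0.
Proof. by apply: (addrI (pairing_r 0 z)); rewrite -pairing_rDl !addr0. Qed.

Lemma pairing_l_tens eta xi w :
  pairing_l (tens xi w : formsE T E) eta = form_ract (form_star w) (hform xi eta).
Proof. exact: tlift_tens (pairing_l_balanced eta). Qed.

Lemma pairing_lDl eta z z' :
  pairing_l (z + z') eta = pairing_l z eta + pairing_l z' eta.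
Proof. exact: tliftD (pairing_l_balanced eta) z z'. Qed.

Lemma pairing_l0l eta : pairing_l (0 : formsE T E) eta = 0.
Proof. exact: tlift0 (pairing_l_balanced eta). Qed.

Lemma pairing_lDr eta eta' z :
  pairing_l z (eta + eta') = pairing_l z eta + pairing_l z eta'.
Proof.
rewrite /pairing_l !tliftE -big_split; apply: eq_bigr => p _ /=.
by rewrite hformDr form_ractDr.
Qed.

Lemma pairing_l0r z : pairing_l z 0 = 0.
Proof. by apply: (addrI (pairing_l z 0)); rewrite -pairing_lDr !addr0. Qed.

Lemma formsE_ract_tens xi w a :
  formsE_ract (tens xi w : formsE T E) a = tens xi (form_ract w a).
Proof. exact: tlift_tens (formsE_ract_balanced a). Qed.

Lemma formsE_ractDl z z' a :
  formsE_ract (z + z') a = formsE_ract z a + formsE_ract z' a.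
Proof. exact: tliftD (formsE_ract_balanced a) z z'. Qed.

Lemma formsE_ract0l a : formsE_ract (0 : formsE T E) a = 0.
Proof. exact: tlift0 (formsE_ract_balanced a). Qed.

Lemma formsE_ractDr z a b :
  formsE_ract z (a + b) = formsE_ract z a + formsE_ract z b.
Proof.
rewrite /formsE_ract !tliftE -big_split; apply: eq_bigr => p _ /=.
by rewrite form_ractDr tensDr.
Qed.

Lemma formsE_ract0r z : formsE_ract z 0 = 0.
Proof. by apply: (addrI (formsE_ract z 0)); rewrite -formsE_ractDr !addr0. Qed.

End Pairings.

(** * One-forms on a product triple *)

Section ProductForms.
Variables (C : numClosedFieldType) (A1 A2 : starAlgType C).
Variables (T1 : evenTriple A1) (T2 : evenTriple A2) (T : evenTriple (A1 ⊗ A2)).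
Variables (t : T1 -> T2 -> T) (hT : is_product t).

Let form1E := form1P hT.
Let form2E := form2P hT.

Lemma prodZl (c : C) x1 x2 : t (c *: x1) x2 = c *: t x1 x2.
Proof. by have [[l _ _ _] _ _ _] := hT; exact: (linZ (l x2)). Qed.

Lemma prodZr (c : C) x1 x2 : t x1 (c *: x2) = c *: t x1 x2.
Proof. by have [[_ l _ _] _ _ _] := hT; exact: (linZ (l x1)). Qed.

(** The vectors [t x1 x2] span a dense subspace, which has trivial orthogonal
    complement. *)
Lemma prod_ip_inj (y z : T) :
  (forall x1 x2, ip (t x1 x2) y = ip (t x1 x2) z :> C) -> y = z.
Proof.
move=> h; have [[_ _ _ dt] _ _ _] := hT.
apply/eqP; rewrite -subr_eq0; apply/eqP; apply: (dense_ip0 dt) => _ [s [hs ->]].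
elim: s hs => [|p s IH] hs; first by rewrite big_nil ip0l.
rewrite big_cons ipDl ipZl IH ?addr0; last first.
  by move=> q qs; apply: hs; rewrite in_cons qs orbT.
have [x1 [x2 ->]] := hs p (mem_head _ _).
by rewrite ipDr ipNr h subrr mulr0.
Qed.

(** A one-form is determined by its star, and the star by the inner products
    with elementary tensors. *)
Lemma oneform_prodP (w w' : oneform T) :
  (forall x1 x2, w (t x1 x2) = w' (t x1 x2)) -> w = w'.
Proof.
move=> h; apply: form_star_inj; apply: oneform_funP => y.
by apply: prod_ip_inj => x1 x2; rewrite -!form_starE h.
Qed.

(** Adjointness tested on elementary tensors in both arguments; this is how the
    stars of product forms are computed. *)
Lemma form_star_prod (w w' : oneform T) :
  (forall x1 x2 y1 y2, ip (w (t x1 x2)) (t y1 y2) = ip (t x1 x2) (w' (t y1 y2)) :> C) ->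
  form_star w = w'.
Proof.
move=> h; apply: oneform_prodP => y1 y2; apply: prod_ip_inj => x1 x2.
by rewrite -form_starE.
Qed.

Lemma form1D w1 w1' a2 : form1 t (w1 + w1') a2 = form1 t w1 a2 + form1 t w1' a2.
Proof.
apply: oneform_prodP => x1 x2.
by rewrite add_formE !form1E -(prodDl hT).
Qed.

Lemma form1B w1 w1' a2 : form1 t (w1 - w1') a2 = form1 t w1 a2 - form1 t w1' a2.
Proof. by apply/eqP; rewrite eq_sym subr_eq -form1D subrK. Qed.

Lemma form10 a2 : form1 t 0 a2 = 0.
Proof. by rewrite -(subrr (0 : oneform T1)) form1B subrr. Qed.

Lemma form1Z (c : C) w1 a2 : form1 t (c *: w1) a2 = c *: form1 t w1 a2.
Proof.
apply: oneform_prodP => x1 x2.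
by rewrite scale_formE !form1E -prodZl.
Qed.

Lemma form2D a1 w2 w2' : form2 t a1 (w2 + w2') = form2 t a1 w2 + form2 t a1 w2'.
Proof.
apply: oneform_prodP => x1 x2.
by rewrite add_formE !form2E -(prodDr hT).
Qed.

Lemma form2B a1 w2 w2' : form2 t a1 (w2 - w2') = form2 t a1 w2 - form2 t a1 w2'.
Proof. by apply/eqP; rewrite eq_sym subr_eq -form2D subrK. Qed.

Lemma form20 a1 : form2 t a1 0 = 0.
Proof. by rewrite -(subrr (0 : oneform T2)) form2B subrr. Qed.

Lemma form2Z (c : C) a1 w2 : form2 t a1 (c *: w2) = c *: form2 t a1 w2.
Proof.
apply: oneform_prodP => x1 x2.
by rewrite scale_formE !form2E -prodZr.
Qed.

Lemma form1_lact a1 a2 w1 b2 :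
  form_lact (tens a1 a2 : A1 ⊗ A2) (form1 t w1 b2) =
    form1 t (form_lact a1 w1) (a2 * b2).
Proof.
by apply: oneform_prodP => x1 x2; rewrite /= !form1E (prod_rep hT) repM.
Qed.

Lemma form1_ract a1 a2 w1 b2 :
  form_ract (form1 t w1 b2) (tens a1 a2 : A1 ⊗ A2) =
    form1 t (form_ract w1 a1) (b2 * a2).
Proof.
by apply: oneform_prodP => x1 x2; rewrite /= (prod_rep hT) !form1E repM.
Qed.

Lemma form1_star w1 b2 :
  form_star (form1 t w1 b2) = form1 t (form_star w1) (b2^†).
Proof.
have [[_ _ tip _] _ _ _] := hT.
apply: form_star_prod => x1 x2 y1 y2.
by rewrite !form1E !tip form_starE rep_star.
Qed.

Lemma form2_lact a1 a2 b1 w2 :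
  form_lact (tens a1 a2 : A1 ⊗ A2) (form2 t b1 w2) =
    form2 t (a1 * b1) (form_lact a2 w2).
Proof.
apply: oneform_prodP => x1 x2.
by rewrite /= !form2E (prod_rep hT) repM !grading_rep.
Qed.

Lemma form2_ract a1 a2 b1 w2 :
  form_ract (form2 t b1 w2) (tens a1 a2 : A1 ⊗ A2) =
    form2 t (b1 * a1) (form_ract w2 a2).
Proof.
by apply: oneform_prodP => x1 x2; rewrite /= (prod_rep hT) !form2E repM.
Qed.

Lemma form2_star b1 w2 :
  form_star (form2 t b1 w2) = form2 t (b1^†) (form_star w2).
Proof.
have [[_ _ tip _] _ _ _] := hT.
apply: form_star_prod => x1 x2 y1 y2.
by rewrite !form2E !tip form_starE grading_selfadjoint rep_star grading_rep.
Qed.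

(** The Leibniz rule for [(a1 (x) 1) (1 (x) a2)], where [a1 (x) 1]
    commutes with [gamma1 (x) D2] and [1 (x) a2] commutes with [D1 (x) 1]. *)
Lemma differential_tens a1 a2 :
  differential T (tens a1 a2 : A1 ⊗ A2) =
    form1 t (differential T1 a1) a2 + form2 t a1 (differential T2 a2).
Proof.
have -> : (tens a1 a2 : A1 ⊗ A2) = (tens a1 1 : A1 ⊗ A2) * (tens 1 a2 : A1 ⊗ A2).
  by rewrite [RHS]tmul_tens mulr1 mul1r.
rewrite differentialM; congr (_ + _); apply: oneform_prodP => x1 x2 /=.
  by rewrite (prod_rep hT) (prod_commutator1 hT) form1E rep1.
by rewrite (prod_commutator2 hT) (prod_rep hT) form2E rep1 grading_rep.
Qed.

End ProductForms.

(** * The product connection *)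

Section ProductConnection.
Variables (C : numClosedFieldType) (A1 A2 : starAlgType C).
Variables (T1 : evenTriple A1) (T2 : evenTriple A2) (T : evenTriple (A1 ⊗ A2)).
Variables (t : T1 -> T2 -> T) (hT : is_product t).
Variables (E1 : hmod A1) (E2 : hmod A2).
Local Notation E := (hmod_tens E1 E2).
Local Notation EOm := (formsE T E).
Local Notation "e1 '⊠' e2" := (tens e1 e2 : hm_space E) (at level 40).

(** With one of [a1], [a2] equal to [1], this moves the action on a single
    module into the one-form. *)
Lemma tens_ract_act e1 e2 a1 a2 (w : oneform T) :
  (tens (ract e1 a1 ⊠ ract e2 a2) w : EOm) =
    tens (e1 ⊠ e2) (form_lact (tens a1 a2 : A1 ⊗ A2) w).
Proof. by rewrite -tens_ract_tens; exact: tens_act. Qed.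

Lemma iota1_inner_balanced e2 : balanced (ract_op E1) (lact_op T1)
  (fun e1 w1 => tens (e1 ⊠ e2) (form1 t w1 1) : EOm).
Proof.
split=> [u u' v|u v v'|c u v|a u v].
- by rewrite tensDl [LHS]tensDl.
- by rewrite (form1D hT) [LHS]tensDr.
- by rewrite (form1Z hT) tensZl [LHS]tensZl [RHS]tensZr.
- have /= := tens_ract_act u e2 a 1 (form1 t v 1).
  by rewrite ract1 (form1_lact hT) mulr1.
Qed.

Lemma iota2_inner_balanced e1 : balanced (ract_op E2) (lact_op T2)
  (fun e2 w2 => tens (e1 ⊠ e2) (form2 t 1 w2) : EOm).
Proof.
split=> [u u' v|u v v'|c u v|a u v].
- by rewrite tensDr [LHS]tensDl.
- by rewrite (form2D hT) [LHS]tensDr.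
- by rewrite (form2Z hT) tensZr [LHS]tensZl [RHS]tensZr.
- have /= := tens_ract_act e1 u 1 a (form2 t 1 v).
  by rewrite ract1 (form2_lact hT) mulr1.
Qed.

Lemma iota1_balanced : balanced (@scalop C (formsE T1 E1)) (@scalop C E2)
  (fun z1 e2 => tlift (fun e1 w1 => tens (e1 ⊠ e2) (form1 t w1 1) : EOm) z1).
Proof.
apply: balancedC => [z z' e|z e e'|c z e].
- exact: tliftD (iota1_inner_balanced e) z z'.
- rewrite !tliftE -big_split; apply: eq_bigr => p _ /=.
  by rewrite tensDr [LHS]tensDl.
- rewrite [LHS](tlift_scale c z (iota1_inner_balanced e)) !tliftE.
  by apply: eq_bigr => p _; rewrite tensZl tensZr.
Qed.

Lemma iota2_balanced : balanced (@scalop C E1) (@scalop C (formsE T2 E2))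
  (fun e1 z2 => tlift (fun e2 w2 => tens (e1 ⊠ e2) (form2 t 1 w2) : EOm) z2).
Proof.
apply: balancedC => [e e' z|e z z'|c e z].
- rewrite !tliftE -big_split; apply: eq_bigr => p _ /=.
  by rewrite tensDl [LHS]tensDl.
- exact: tliftD (iota2_inner_balanced e) z z'.
- rewrite [RHS](tlift_scale c z (iota2_inner_balanced e)) !tliftE.
  by apply: eq_bigr => p _; rewrite tensZl tensZr.
Qed.

Lemma iota1_tens e1 w1 e2 :
  iota1 t (tens (tens e1 w1 : formsE T1 E1) e2) = tens (e1 ⊠ e2) (form1 t w1 1).
Proof.
rewrite /iota1 [LHS](tlift_tens _ _ iota1_balanced).
exact: tlift_tens (iota1_inner_balanced e2).
Qed.

Lemma iota2_tens e1 e2 w2 :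
  iota2 t (tens e1 (tens e2 w2 : formsE T2 E2)) = tens (e1 ⊠ e2) (form2 t 1 w2).
Proof.
rewrite /iota2 [LHS](tlift_tens _ _ iota2_balanced).
exact: tlift_tens (iota2_inner_balanced e1).
Qed.

Lemma iota1_linear : linear (@iota1 _ _ _ _ _ _ t E1 E2).
Proof.
apply: (tlift_linear iota1_balanced) => c z e.
rewrite [LHS](tlift_scale c z (iota1_inner_balanced e)) tliftE scaler_sumr.
by apply: eq_bigr => p _; rewrite tensZl [LHS]tensZl.
Qed.

Lemma iota2_linear : linear (@iota2 _ _ _ _ _ _ t E1 E2).
Proof.
apply: (tlift_linear iota2_balanced) => c e z.
rewrite tliftE scaler_sumr.
by apply: eq_bigr => p _; rewrite tensZl [LHS]tensZl.
Qed.

Let iota1D := linD iota1_linear.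
Let iota2D := linD iota2_linear.

Lemma iota1_0 : iota1 t (0 : formsE T1 E1 ⊗ E2) = 0.
Proof. exact: tlift0 iota1_balanced. Qed.

Lemma iota2_0 : iota2 t (0 : E1 ⊗ formsE T2 E2) = 0.
Proof. exact: tlift0 iota2_balanced. Qed.

(** The factor [a2] acting on [e2] is absorbed by the one-form [w1 (x) 1].  This
    is the term [e1 (x) d1 a1 (x) e2 a2] produced by the Leibniz rule for the
    first connection. *)
Lemma iota1_tens_ract e1 w1 e2 a2 :
  iota1 t (tens (tens e1 w1 : formsE T1 E1) (ract e2 a2)) =
    tens (e1 ⊠ e2) (form1 t w1 a2).
Proof.
have := tens_ract_act e1 e2 1 a2 (form1 t w1 1).
by rewrite ract1 (form1_lact hT) form_lact1 mulr1 iota1_tens.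
Qed.

(** The factor [a1] acting on [e1] crosses [gamma1], with which it commutes. *)
Lemma iota2_tens_ract e1 a1 e2 w2 :
  iota2 t (tens (ract e1 a1) (tens e2 w2 : formsE T2 E2)) =
    tens (e1 ⊠ e2) (form2 t a1 w2).
Proof.
have := tens_ract_act e1 e2 a1 1 (form2 t 1 w2).
by rewrite ract1 (form2_lact hT) form_lact1 mulr1 iota2_tens.
Qed.

(** The right action of [a2] on [E2] and the balancing over [A2] agree because
    [1 (x) a2] commutes with the forms [w1 (x) 1]. *)
Lemma iota1_ract (z : formsE T1 E1) (e2 : E2) a1 a2 :
  iota1 t (tens (formsE_ract z a1) (ract e2 a2)) =
    formsE_ract (iota1 t (tens z e2)) (tens a1 a2 : A1 ⊗ A2).
Proof.
elim/tensor_ind: z => [|e1 w1|z z' IH IH'].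
- by rewrite formsE_ract0l !tens0l iota1_0 formsE_ract0l.
- rewrite formsE_ract_tens iota1_tens_ract iota1_tens formsE_ract_tens.
  by rewrite (form1_ract hT) mul1r.
- by rewrite formsE_ractDl !tensDl !iota1D IH IH' formsE_ractDl.
Qed.

(** Here [a1 (x) 1] commutes with [gamma1 (x) w2], as [gamma1] commutes with [A1]. *)
Lemma iota2_ract (e1 : E1) (z : formsE T2 E2) a1 a2 :
  iota2 t (tens (ract e1 a1) (formsE_ract z a2)) =
    formsE_ract (iota2 t (tens e1 z)) (tens a1 a2 : A1 ⊗ A2).
Proof.
elim/tensor_ind: z => [|e2 w2|z z' IH IH'].
- by rewrite formsE_ract0l !tens0r iota2_0 formsE_ract0l.
- rewrite formsE_ract_tens iota2_tens_ract iota2_tens formsE_ract_tens.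
  by rewrite (form2_ract hT) mul1r.
- by rewrite formsE_ractDl !tensDr !iota2D IH IH' formsE_ractDl.
Qed.

Lemma pairing_r_iota1 e1 e2 (z : formsE T1 E1) (f2 : E2) :
  pairing_r (e1 ⊠ e2) (iota1 t (tens z f2)) =
    form1 t (pairing_r e1 z) (hform e2 f2).
Proof.
elim/tensor_ind: z => [|f1 w1|z z' IH IH'].
- by rewrite tens0l iota1_0 !pairing_r0r (form10 hT).
- rewrite iota1_tens !pairing_r_tens [hform _ _]tens_hform_tens.
  by rewrite (form1_lact hT) mulr1.
- by rewrite tensDl iota1D !pairing_rDr IH IH' (form1D hT).
Qed.

Lemma pairing_r_iota2 e1 e2 (f1 : E1) (z : formsE T2 E2) :
  pairing_r (e1 ⊠ e2) (iota2 t (tens f1 z)) =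
    form2 t (hform e1 f1) (pairing_r e2 z).
Proof.
elim/tensor_ind: z => [|f2 w2|z z' IH IH'].
- by rewrite tens0r iota2_0 !pairing_r0r (form20 hT).
- rewrite iota2_tens !pairing_r_tens [hform _ _]tens_hform_tens.
  by rewrite (form2_lact hT) mulr1.
- by rewrite tensDr iota2D !pairing_rDr IH IH' (form2D hT).
Qed.

Lemma pairing_l_iota1 (z : formsE T1 E1) (e2 : E2) f1 f2 :
  pairing_l (iota1 t (tens z e2)) (f1 ⊠ f2) =
    form1 t (pairing_l z f1) (hform e2 f2).
Proof.
elim/tensor_ind: z => [|e1 w1|z z' IH IH'].
- by rewrite tens0l iota1_0 !pairing_l0l (form10 hT).
- rewrite iota1_tens !pairing_l_tens [hform _ _]tens_hform_tens.
  by rewrite (form1_star hT) (form1_ract hT) star1 mul1r.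
- by rewrite tensDl iota1D !pairing_lDl IH IH' (form1D hT).
Qed.

Lemma pairing_l_iota2 (e1 : E1) (z : formsE T2 E2) f1 f2 :
  pairing_l (iota2 t (tens e1 z)) (f1 ⊠ f2) =
    form2 t (hform e1 f1) (pairing_l z f2).
Proof.
elim/tensor_ind: z => [|e2 w2|z z' IH IH'].
- by rewrite tens0r iota2_0 !pairing_l0l (form20 hT).
- rewrite iota2_tens !pairing_l_tens [hform _ _]tens_hform_tens.
  by rewrite (form2_star hT) (form2_ract hT) star1 mul1r.
- by rewrite tensDr iota2D !pairing_lDl IH IH' (form2D hT).
Qed.

Variables (nabla1 : E1 -> formsE T1 E1) (nabla2 : E2 -> formsE T2 E2).

Definition prod_nabla_gen (e1 : E1) (e2 : E2) : EOm :=
  iota1 t (tens (nabla1 e1) e2) + iota2 t (tens e1 (nabla2 e2)).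

Definition prod_nabla : E -> EOm := tlift prod_nabla_gen.

Hypotheses (con1 : is_connection nabla1) (con2 : is_connection nabla2).

Let lin1 : linear nabla1 := proj1 con1.
Let lin2 : linear nabla2 := proj1 con2.

Lemma prod_nabla_genZ (c : C) e1 e2 :
  prod_nabla_gen (c *: e1) e2 = c *: prod_nabla_gen e1 e2.
Proof.
rewrite /prod_nabla_gen (linZ lin1) scalerDr !tensZl.
by rewrite (linZ iota1_linear) (linZ iota2_linear).
Qed.

Lemma prod_nabla_balanced :
  balanced (@scalop C E1) (@scalop C E2) prod_nabla_gen.
Proof.
apply: balancedC => [u u' v|u v v'|c u v].
- by rewrite /prod_nabla_gen (linD lin1) !tensDl iota1D iota2D addrACA.
- by rewrite /prod_nabla_gen (linD lin2) !tensDr iota1D iota2D addrACA.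
- rewrite prod_nabla_genZ /prod_nabla_gen (linZ lin2) scalerDr !tensZr.
  by rewrite (linZ iota1_linear) (linZ iota2_linear).
Qed.

Lemma prod_nabla_tens e1 e2 : prod_nabla (e1 ⊠ e2) = prod_nabla_gen e1 e2.
Proof. exact: tlift_tens prod_nabla_balanced. Qed.

Lemma prod_nabla_linear : linear prod_nabla.
Proof. exact: (tlift_linear prod_nabla_balanced prod_nabla_genZ). Qed.

Lemma prod_nablaD x y : prod_nabla (x + y) = prod_nabla x + prod_nabla y.
Proof. exact: (linD prod_nabla_linear). Qed.

Lemma prod_nabla0 : prod_nabla 0 = 0.
Proof. exact: tlift0 prod_nabla_balanced. Qed.

Lemma prod_nabla_unique (nabla : E -> EOm) : linear nabla ->
  (forall e1 e2, nabla (e1 ⊠ e2) = prod_nabla_gen e1 e2) -> nabla = prod_nabla.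
Proof.
move=> lin h; apply/funext; elim/tensor_ind => [|e1 e2|x y IH IH'].
- rewrite prod_nabla0.
  by apply: (addrI (nabla 0)); rewrite -(linD lin) !addr0.
- by rewrite h prod_nabla_tens.
- by rewrite (linD lin) IH IH' prod_nablaD.
Qed.

(** On elementary tensors the Leibniz rules of the two connections contribute
    exactly the two summands of [d (a1 (x) a2)]. *)
Lemma prod_nabla_connection : is_connection prod_nabla.
Proof.
have [_ leib1] := con1; have [_ leib2] := con2.
split=> [|xi a]; first exact: prod_nabla_linear.
elim/tensor_ind: xi => [|e1 e2|x y IH IH'].
- by rewrite [ract 0 a](tmap20l (ract_sesqui E1) (ract_sesqui E2)) prod_nabla0
    formsE_ract0l add0r [RHS](balanced0l _ (tens_balanced _ _)).
- elim/tensor_ind: a => [|a1 a2|a b IH IH'].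
  + rewrite [ract _ 0](tmap20r (ract_sesqui E1) (ract_sesqui E2)) prod_nabla0.
    rewrite formsE_ract0r differential0 add0r.
    by apply: (addrI (tens (e1 ⊠ e2) 0 : EOm)); rewrite -[RHS]tensDr !addr0.
  + rewrite [ract _ _]tens_ract_tens !prod_nabla_tens /prod_nabla_gen leib1 leib2.
    rewrite tensDl tensDr iota1D iota2D iota1_ract iota2_ract iota1_tens_ract.
    rewrite iota2_tens_ract (differential_tens hT) tensDr formsE_ractDl.
    by rewrite addrACA.
  + rewrite (linD (ract_linearr (_ : hm_space E))) prod_nablaD IH IH'.
    by rewrite differentialD formsE_ractDr [in RHS]tensDr addrACA.
- rewrite (linD (ract_linear a)) !prod_nablaD IH IH' formsE_ractDl.
  by rewrite [in RHS]tensDl addrACA.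
Qed.

(** On elementary tensors the terms of the first connection share the factor
    [<e2, f2>] and those of the second the factor [gamma1 <e1, f1>], so the two
    compatibility equations apply separately and give the two summands of
    [d <e1 (x) e2, f1 (x) f2>]. *)
Lemma prod_nabla_compatible :
  (forall xi eta, pairing_r xi (nabla1 eta) - pairing_l (nabla1 xi) eta =
     differential T1 (hform xi eta)) ->
  (forall xi eta, pairing_r xi (nabla2 eta) - pairing_l (nabla2 xi) eta =
     differential T2 (hform xi eta)) ->
  compatible_connection prod_nabla.
Proof.
move=> comp1 comp2; split=> [|xi eta].
  exact: prod_nabla_connection.
elim/tensor_ind: xi => [|e1 e2|x y IH IH'].
- by rewrite prod_nabla0 pairing_r0l pairing_l0l subr0 hform0l differential0.
- elim/tensor_ind: eta => [|f1 f2|x y IH IH'].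
  + by rewrite prod_nabla0 pairing_r0r pairing_l0r subr0 hform0r differential0.
  + rewrite !prod_nabla_tens /prod_nabla_gen pairing_rDr pairing_lDl.
    rewrite pairing_r_iota1 pairing_r_iota2 pairing_l_iota1 pairing_l_iota2.
    rewrite [hform _ _ in RHS]tens_hform_tens (differential_tens hT).
    by rewrite -comp1 -comp2 (form1B hT) (form2B hT) opprD addrACA.
  + by rewrite prod_nablaD pairing_rDr pairing_lDr opprD addrACA IH IH' hformDr
      differentialD.
- by rewrite prod_nablaD pairing_rDl pairing_lDl opprD addrACA IH IH' hformDl
    differentialD.
Qed.

End ProductConnection.

Theorem proposition3p8 (R : realType) (A1 A2 : starAlgType R[i])
    (hA1 : holomorphically_stable A1) (hA2 : holomorphically_stable A2)
    (T1 : evenTriple A1) (T2 : evenTriple A2)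
    (T : evenTriple (A1 ⊗ A2)) (t : T1 -> T2 -> T) (hT : is_product t)
    (E1 : hmod A1) (E2 : hmod A2)
    (hE1 : hermitian_fgp E1) (hE2 : hermitian_fgp E2)
    (nabla1 : E1 -> formsE T1 E1) (nabla2 : E2 -> formsE T2 E2)
    (h1 : compatible_connection nabla1) (h2 : compatible_connection nabla2) :
  exists nabla : hmod_tens E1 E2 -> formsE T (hmod_tens E1 E2),
    [/\ forall e1 e2, nabla (tens e1 e2) =
          iota1 t (tens (nabla1 e1) e2) + iota2 t (tens e1 (nabla2 e2)),
        compatible_connection nabla
      & forall nabla' : hmod_tens E1 E2 -> formsE T (hmod_tens E1 E2),
          linear nabla' ->
          (forall e1 e2, nabla' (tens e1 e2) =
             iota1 t (tens (nabla1 e1) e2) + iota2 t (tens e1 (nabla2 e2))) ->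
          nabla' = nabla].
Proof.
have [con1 comp1] := h1; have [con2 comp2] := h2.
exists (prod_nabla t nabla1 nabla2); split.
- exact: prod_nabla_tens.
- exact: prod_nabla_compatible.
- exact: prod_nabla_unique.
Qed.
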